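(* Let $n\ge 2$ and let $\mathbb{H}^n$ be the $n$-dimensional hyperbolic space with its $C_0$ Higson compactification $h_0\mathbb{H}^n$. Then the Čech cohomology $\check H^k(h_0\mathbb{H}^n;\mathbb{Z})=0$ for all $k>1$.
   Context: The $C_0$ coarse structure on a metric space $(X,d)$ consists of all sets $E\subset X\times X$ such that for every $\epsilon>0$ there is a compact $K\subset X$ with $d(x,y)<\epsilon$ for all $(x,y)\in E\setminus(K\times K)$ (controlled sets). A bounded continuous $f:X\to\mathbb{C}$ is a Higson function if for every controlled set $E$ the function $(x,y)\mapsto f(x)-f(y)$ restricted to $E$ vanishes at infinity; $C_{h_0}(X)$ denotes the algebra of bounded continuous Higson functions. The $C_0$ Higson compactification $h_0X$ is the compactification of $X$ with $C(h_0X)=C_{h_0}(X)$. (For proper geodesic $X$, $C_{h_0}(X)$ is exactly the set of bounded uniformly continuous functions.) *)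

(* Defs.v *)
From Stdlib Require Import Reals Lra ZArith List.
Open Scope R_scope.

Definition mopen {X : Type} (d : X -> X -> R) (U : X -> Prop) : Prop :=
  forall x, U x -> exists r, 0 < r /\ forall y, d x y < r -> U y.

Definition mcompact {X : Type} (d : X -> X -> R) (K : X -> Prop) : Prop :=
  forall (I : Type) (U : I -> X -> Prop),
    (forall i, mopen d (U i)) ->
    (forall x, K x -> exists i, U i x) ->
    exists l : list I, forall x, K x -> exists i, In i l /\ U i x.

Definition c0_controlled {X : Type} (d : X -> X -> R) (E : X -> X -> Prop) : Prop :=
  forall eps, 0 < eps -> exists K, mcompact d K /\
    forall x y, E x y -> ~ (K x /\ K y) -> d x y < eps.

Definition mcontinuous {X : Type} (d : X -> X -> R) (f : X -> R) : Prop :=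
  forall x eps, 0 < eps -> exists delta, 0 < delta /\
    forall y, d x y < delta -> Rabs (f x - f y) < eps.

Definition fbounded {X : Type} (f : X -> R) : Prop :=
  exists M, forall x, Rabs (f x) <= M.

Definition higson_cond {X : Type} (d : X -> X -> R) (f : X -> R) : Prop :=
  forall E, c0_controlled d E -> forall eps, 0 < eps ->
    exists K, mcompact d K /\
      forall x y, E x y -> ~ (K x /\ K y) -> Rabs (f x - f y) < eps.

Definition is_higson_fun {X : Type} (d : X -> X -> R) (f : X -> R) : Prop :=
  fbounded f /\ mcontinuous d f /\ higson_cond d f.

Definition HigsonFun (X : Type) (d : X -> X -> R) : Type :=
  { f : X -> R | is_higson_fun d f }.

(* ---------- The C_0 Higson compactification h_0 X ----------
   Closure of the image of X under x |-> (f x)_{f in C_h0(X)} in the product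
   space R^{C_h0(X)}, with the subspace of the product topology. *)

Definition h0pt (X : Type) (d : X -> X -> R) : Type :=
  { phi : HigsonFun X d -> R |
    forall (l : list (HigsonFun X d)) (eps : R), 0 < eps ->
      exists x : X, forall f, In f l -> Rabs (phi f - proj1_sig f x) < eps }.

Definition h0open (X : Type) (d : X -> X -> R) (U : h0pt X d -> Prop) : Prop :=
  forall p, U p -> exists (l : list (HigsonFun X d)) (eps : R), 0 < eps /\
    forall q, (forall f, In f l -> Rabs (proj1_sig q f - proj1_sig p f) < eps) -> U q.

(* ---------- Cech cohomology with Z coefficients ----------
   H^k(Y;Z) = colim over open covers of the simplicial cohomology of the nerve
   (ordered cochains).  Vanishing of the colimit in degree k >= 1 means: every
   k-cocycle on the nerve of an open cover becomes a coboundary after pulling back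
   along some refinement. *)

Definition open_cover {Y I : Type} (openY : (Y -> Prop) -> Prop) (U : I -> Y -> Prop) : Prop :=
  (forall i, openY (U i)) /\ (forall y, exists i, U i y).

Definition nonempty_inter {Y I : Type} (U : I -> Y -> Prop) (s : list I) : Prop :=
  exists y, forall i, In i s -> U i y.

Definition face {I : Type} (j : nat) (s : list I) : list I :=
  firstn j s ++ skipn (S j) s.

Definition cobound {I : Type} (c : list I -> Z) (s : list I) : Z :=
  fold_right Z.add 0%Z
    (map (fun j => ((if Nat.even j then 1 else -1) * c (face j s))%Z)
         (seq 0 (length s))).

Definition nerve_cocycle {Y I : Type} (U : I -> Y -> Prop) (k : nat) (c : list I -> Z) : Prop :=
  forall s, length s = S (S k) -> nonempty_inter U s -> cobound c s = 0%Z.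

Definition nerve_coboundary {Y I : Type} (U : I -> Y -> Prop) (k : nat) (c : list I -> Z) : Prop :=
  exists b : list I -> Z,
    forall s, length s = S k -> nonempty_inter U s -> c s = cobound b s.

Definition cech_vanishes (Y : Type) (openY : (Y -> Prop) -> Prop) (k : nat) : Prop :=
  forall (I : Type) (U : I -> Y -> Prop), open_cover openY U ->
  forall c : list I -> Z, nerve_cocycle U k c ->
    exists (J : Type) (V : J -> Y -> Prop) (lam : J -> I),
      open_cover openY V /\
      (forall j y, V j y -> U (lam j) y) /\
      nerve_coboundary V k (fun t => c (map lam t)).

(* ---------- Hyperbolic n-space, upper half-space model ----------
   Points x : nat -> R with x i = 0 for i >= n and x (n-1) > 0. *)

Definition Hpt (n : nat) : Type :=
  { x : nat -> R | (forall i, (n <= i)%nat -> x i = 0) /\ 0 < x (pred n) }.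

Definition arcosh (t : R) : R := ln (t + sqrt (t * t - 1)).

Definition sqdist (n : nat) (x y : nat -> R) : R :=
  fold_right Rplus 0 (map (fun i => (x i - y i) * (x i - y i)) (seq 0 n)).

Definition hdist (n : nat) (p q : Hpt n) : R :=
  let x := proj1_sig p in let y := proj1_sig q in
  arcosh (1 + sqdist n x y / (2 * x (pred n) * y (pred n))).

(* Main.v *)
(* Small tuples of points of hyperbolic space carry the cohomology of [h_0 H^n]: by compactness an
   open cover of [h_0 H^n] is refined by finitely many bounded uniformly continuous functions, so a
   cocycle on its nerve becomes a bounded integral cocycle on tuples of small diameter, and
   conversely a bounded integral primitive on small tuples of lattice points takes finitely many
   values and is therefore a cochain on a finite uniform cover, which extends to [h_0 H^n].

   Primitives on small tuples come from the upward flow of the upper half space, truncated at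
   height [exp (del M)] and followed by a rounding of the horizontal coordinates to a grid of mesh
   proportional to the height; consecutive values of [M] give uniformly close maps, hence a chain
   homotopy. For a fixed grid every tuple is eventually collapsed, which gives an integral
   primitive [bi]. Averaging over all shifts of the grid, the flow contracts horizontal edges
   exponentially, and in degree [k > 1] this gives a bounded real primitive [br]. Finally
   [bi - br] is a cocycle, [bi - br = dl g], and [bi - dl (floor g) = br + dl (g - floor g)] is both
   integral and bounded. *)

From mathcomp Require classical.filter.
Require Import Defs.
From Stdlib Require Import Reals ZArith List Lra Lia.
From Stdlib Require Import FunctionalExtensionality Classical ClassicalEpsilon.
Import ListNotations.
Open Scope R_scope.
Set Bullet Behavior "Strict Subproofs".

(** * Cochains on tuples *)

(** The rounding is there because the flow alone makes edges short but never degenerate, and a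
    cochain is not continuous: short tuples may carry large values, only degenerate ones can be
    forced to carry none. Ordered cochains need not vanish on degenerate tuples either, so each
    cochain is first replaced by the cohomologous [phi], which does. With a fixed grid, the height
    at which a tuple collapses depends on its position relative to the walls of all the coarser
    grids, so that no uniform bound results. For a random shift, a wall separates two vertices with
    probability at most about their distance divided by the mesh, and this decays geometrically in
    the level. The degree enters because the homotopy of a [k]-cochain is evaluated on tuples of [k]
    vertices. One vertex still contributes its vertical path at every level, however high; from two
    vertices on, a collapsed tuple contributes a degenerate prism, hence nothing. *)

Fixpoint dl {Q : Type} (c : list Q -> R) (s : list Q) : R :=
  match s with
  | [] => 0
  | x :: s' => c s' - dl (fun t => c (x :: t)) s'
  end.

Lemma cobound_cons {I : Type} (c : list I -> Z) x s :
  cobound c (x :: s) = (c s - cobound (fun t => c (x :: t)) s)%Z.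
Proof.
  unfold cobound. cbn [length seq map fold_right].
  rewrite <- seq_shift, map_map.
  replace (face 0 (x :: s)) with s by reflexivity.
  change (Nat.even 0) with true. cbv iota.
  assert (E : forall l : list nat,
    fold_right Z.add 0%Z (map (fun j => ((if Nat.even (S j) then 1 else -1) * c (face (S j) (x :: s)))%Z) l)
    = (- fold_right Z.add 0 (map (fun j => (if Nat.even j then 1 else -1) * c (x :: face j s)) l))%Z).
  { induction l as [|j l IH]; [reflexivity|]. cbn [map fold_right]. rewrite IH.
    rewrite Nat.even_succ, <- Nat.negb_even.
    replace (face (S j) (x :: s)) with (x :: face j s) by reflexivity.
    destruct (Nat.even j); cbn [negb]; lia. }
  rewrite E. lia.
Qed.

(** [dl] is the same alternating sum of faces, written as a recursion on the first vertex so that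
    induction on tuples applies. The complex is augmented: the only face of a one-element list is
    the empty list. *)
Lemma cobound_dl {I : Type} (s : list I) : forall c : list I -> Z,
  IZR (cobound c s) = dl (fun t => IZR (c t)) s.
Proof.
  induction s as [|x s IH]; intros c; [reflexivity|].
  rewrite cobound_cons, minus_IZR, IH. reflexivity.
Qed.

Section Coboundary.
Context {Q : Type}.
Implicit Types (c u v : list Q -> R) (s t : list Q).

Lemma dl_ext s : forall u v,
  (forall t, S (length t) = length s -> incl t s -> u t = v t) -> dl u s = dl v s.
Proof.
  induction s as [|x s IH]; intros u v E; [reflexivity|]. cbn [dl]. f_equal.
  - apply E; [reflexivity|]. now apply incl_tl, incl_refl.
  - apply IH. intros t Ht It. apply E; [cbn; lia|].
    now apply incl_cons; [left|apply incl_tl].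
Qed.

Lemma dl_lin s : forall a b u v,
  dl (fun t => a * u t + b * v t) s = a * dl u s + b * dl v s.
Proof.
  induction s as [|x s IH]; intros a b u v; cbn [dl]; [ring|].
  rewrite (IH a b (fun t => u (x :: t)) (fun t => v (x :: t))). ring.
Qed.

Lemma dl_minus s u v : dl (fun t => u t - v t) s = dl u s - dl v s.
Proof.
  rewrite (dl_ext s _ (fun t => 1 * u t + (-1) * v t)); [rewrite dl_lin; ring|].
  intros; ring.
Qed.

Lemma dl_dl s : forall c, dl (dl c) s = 0.
Proof.
  induction s as [|x s IH]; intros c; [reflexivity|]. cbn [dl].
  rewrite dl_minus, IH. ring.
Qed.

Lemma dl_bound s : forall u B,
  (forall t, S (length t) = length s -> incl t s -> Rabs (u t) <= B) ->
  Rabs (dl u s) <= INR (length s) * B.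
Proof.
  induction s as [|x s IH]; intros u B E.
  - cbn. rewrite Rabs_R0. lra.
  - change (length (x :: s)) with (S (length s)). rewrite S_INR. cbn [dl].
    eapply Rle_trans; [apply Rabs_triang|]. rewrite Rabs_Ropp.
    assert (Rabs (u s) <= B) by (apply E; [reflexivity|apply incl_tl, incl_refl]).
    assert (Rabs (dl (fun t => u (x :: t)) s) <= INR (length s) * B).
    { apply IH. intros t Ht It. apply E; [cbn; lia|].
      now apply incl_cons; [left|apply incl_tl]. }
    lra.
Qed.

Lemma dl_zero s u :
  (forall t, S (length t) = length s -> incl t s -> u t = 0) -> dl u s = 0.
Proof.
  intros E. rewrite (dl_ext s u (fun t => 0 * u t + 0 * u t)).
  - rewrite dl_lin. ring.
  - intros t Ht It. rewrite E; auto. ring.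
Qed.

End Coboundary.

Lemma dl_map {A Q : Type} (f : A -> Q) s : forall c : list Q -> R,
  dl c (map f s) = dl (fun t => c (map f t)) s.
Proof.
  induction s as [|x s IH]; intros c; [reflexivity|]. cbn [dl map]. now rewrite IH.
Qed.

Lemma dl_repeat {Q : Type} (p : Q) m (u : list Q -> R) :
  u (repeat p (S m)) = 0 \/ m = 0%nat -> dl u (repeat p (S (S m))) = 0.
Proof.
  intros [E| ->].
  - apply dl_zero. intros t Ht It. replace t with (repeat p (S m)); [exact E|].
    symmetry. rewrite repeat_length in Ht. replace (S m) with (length t) by lia.
    apply Forall_eq_repeat, Forall_forall. intros y Hy.
    symmetry. apply (repeat_spec (S (S m)) p y), It, Hy.
  - cbn. ring.
Qed.

Definition is_int (r : R) : Prop := exists z, r = IZR z.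

Lemma is_int_minus a b : is_int a -> is_int b -> is_int (a - b).
Proof. intros [x ->] [y ->]. exists (x - y)%Z. now rewrite minus_IZR. Qed.

Lemma is_int_0 : is_int 0.
Proof. now exists 0%Z. Qed.

Lemma dl_int {Q : Type} (s : list Q) : forall u, (forall t, is_int (u t)) -> is_int (dl u s).
Proof.
  induction s as [|x s IH]; intros u E; cbn [dl]; [apply is_int_0|].
  apply is_int_minus; [apply E|]. apply IH. intros; apply E.
Qed.

(** * Normalisation of ordered cochains *)

Section Normalisation.
Context {Q : Type}.
Implicit Types (c u v : list Q -> R) (s t : list Q).

(* Dual of the chain map [phi (x0 .. xk) = x0 * phi (d (x0 .. xk))]; coning kills degenerate
   tuples because two faces of a degenerate tuple cancel. *)
Fixpoint phi (n : nat) c s : R :=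
  match n, s with
  | O, _ => c []
  | S m, [] => 0
  | S m, x :: _ => dl (phi m (fun t => c (x :: t))) s
  end.

Lemma phi_lin n : forall s a b u v,
  phi n (fun t => a * u t + b * v t) s = a * phi n u s + b * phi n v s.
Proof.
  induction n as [|m IH]; intros [|x s] a b u v; cbn [phi]; try ring.
  rewrite <- dl_lin. apply dl_ext. intros t _ _.
  apply (IH t a b (fun t => u (x :: t)) (fun t => v (x :: t))).
Qed.

Lemma phi_bound n : exists K, 0 <= K /\ forall c s B, length s = n ->
  (forall t, length t = n -> incl t s -> Rabs (c t) <= B) -> Rabs (phi n c s) <= K * B.
Proof.
  induction n as [|m [K [HK IH]]].
  - exists 1. split; [lra|]. intros c s B Hs E. cbn [phi].
    assert (Rabs (c []) <= B) by (apply E; [reflexivity|apply incl_nil_l]). lra.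
  - exists (INR (S m) * K). split; [apply Rmult_le_pos; [apply pos_INR|lra]|].
    intros c [|x s] B Hs E; [discriminate|]. cbn [phi]. rewrite Rmult_assoc, <- Hs.
    apply dl_bound. intros t Ht It. apply IH; [lia|].
    intros t' Ht' It'. apply E; [cbn; lia|].
    apply incl_cons; [now left|]. now apply incl_tran with t.
Qed.

Lemma phi_int n : forall c s, (forall t, is_int (c t)) -> is_int (phi n c s).
Proof.
  induction n as [|m IH]; intros c [|x s] E; cbn [phi]; auto using is_int_0.
  apply dl_int. intros t. apply IH. auto.
Qed.

(** After the first vertex [x] is split off, [dl c] becomes [c] minus the coboundary of the cone
    over [x]. By induction the second part contributes a double coboundary. *)
Lemma phi_dl m : forall c s, length s = S m -> phi (S m) (dl c) s = dl (phi m c) s.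
Proof.
  induction m as [|m IH]; intros c [|x s] Hs; try discriminate.
  - destruct s; [|discriminate]. cbn. ring.
  - change (phi (S (S m)) (dl c) (x :: s))
      with (dl (phi (S m) (fun t => c t - dl (fun r => c (x :: r)) t)) (x :: s)).
    rewrite (dl_ext _ _ (fun t => 1 * phi (S m) c t + (-1) * phi (S m) (dl (fun r => c (x :: r))) t)).
    + rewrite dl_lin.
      rewrite (dl_ext _ (phi (S m) (dl (fun r => c (x :: r)))) (dl (phi m (fun r => c (x :: r))))).
      * rewrite dl_dl. ring.
      * intros t Ht _. apply IH. cbn in *; lia.
    + intros t _ _. rewrite <- phi_lin. f_equal.
      apply functional_extensionality. intros; ring.
Qed.

Lemma phi_repeat m : forall c p, phi (S (S m)) c (repeat p (S (S m))) = 0.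
Proof.
  induction m as [|m IH]; intros c p.
  - cbn. ring.
  - change (dl (phi (S (S m)) (fun t => c (p :: t))) (repeat p (S (S (S m)))) = 0).
    apply dl_repeat. left. apply IH.
Qed.

End Normalisation.

(** * Chain homotopies between two images of a tuple *)

Section Homotopy.
Context {Q : Type}.
Implicit Types (c u v : list Q -> R) (ps : list (Q * Q)).
(** A list of pairs records the two images of each vertex. [F] and [G] are duals of two chain maps,
    and [FG_nil] says that they agree on the augmentation. *)
Variables F G : nat -> (list Q -> R) -> list (Q * Q) -> R.
Hypothesis F_lin : forall n ps a b u v,
  F n (fun t => a * u t + b * v t) ps = a * F n u ps + b * F n v ps.
Hypothesis G_lin : forall n ps a b u v,
  G n (fun t => a * u t + b * v t) ps = a * G n u ps + b * G n v ps.
Hypothesis F_dl : forall m c ps, length ps = S m -> F (S m) (dl c) ps = dl (F m c) ps.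
Hypothesis G_dl : forall m c ps, length ps = S m -> G (S m) (dl c) ps = dl (G m c) ps.
Hypothesis FG_nil : forall c, F 0 c [] = G 0 c [].

(* Dual of the cone construction [H (p :: ps) = fst p * (G - F - H d) (p :: ps)] of a chain homotopy
   from [F] to [G]; working with augmented tuples (the empty list in degree -1) makes it uniform. *)
Fixpoint hty (n : nat) c ps : R :=
  match n, ps with
  | S m, p :: _ =>
      let cv := fun t => c (fst p :: t) in
      G (S m) cv ps - F (S m) cv ps - dl (hty m cv) ps
  | _, _ => 0
  end.

Lemma hty_lin n : forall ps a b u v,
  hty n (fun t => a * u t + b * v t) ps = a * hty n u ps + b * hty n v ps.
Proof.
  induction n as [|m IH]; intros [|p ps] a b u v; cbn [hty]; try ring.
  rewrite (dl_ext _ _ (fun t => a * hty m (fun t => u (fst p :: t)) t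
                              + b * hty m (fun t => v (fst p :: t)) t)).
  - rewrite dl_lin, F_lin, G_lin. ring.
  - intros t _ _. apply (IH t a b (fun t => u (fst p :: t)) (fun t => v (fst p :: t))).
Qed.

Lemma hty_dl n : forall c ps, length ps = n ->
  hty n (dl c) ps + dl (hty (pred n) c) ps = G n c ps - F n c ps.
Proof.
  induction n as [|m IH]; intros c [|p ps] Hs; try discriminate.
  - cbn. rewrite FG_nil. ring.
  - cbn [hty pred]. set (cv := fun t => c (fst p :: t)).
    change (fun t => dl c (fst p :: t)) with (fun t => c t - dl cv t).
    replace (fun t => c t - dl cv t) with (fun t => 1 * c t + (-1) * dl cv t)
      by (apply functional_extensionality; intros; ring).
    rewrite F_lin, G_lin, F_dl, G_dl by assumption.
    rewrite (dl_ext _ (hty m _)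
      (fun t => 1 * hty m c t + (-1) * ((G m cv t - F m cv t) - dl (hty (pred m) cv) t))).
    + rewrite dl_lin, !dl_minus, dl_dl. ring.
    + intros t Ht _. rewrite hty_lin. rewrite <- (IH cv t) by (cbn in *; lia). ring.
Qed.

(** Only the values of [c] on tuples drawn from the two images enter, so these bounds also express
    locality. This matters because the cochains in use are cocycles on small tuples only. *)
Hypothesis F_bound : forall n, exists K, 0 <= K /\ forall c ps B, length ps = n ->
  (forall t, length t = n -> incl t (map fst ps ++ map snd ps) -> Rabs (c t) <= B) ->
  Rabs (F n c ps) <= K * B.
Hypothesis G_bound : forall n, exists K, 0 <= K /\ forall c ps B, length ps = n ->
  (forall t, length t = n -> incl t (map fst ps ++ map snd ps) -> Rabs (c t) <= B) ->
  Rabs (G n c ps) <= K * B.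

Lemma hty_bound n : exists K, 0 <= K /\ forall c ps B, length ps = n ->
  (forall t, length t = S n -> incl t (map fst ps ++ map snd ps) -> Rabs (c t) <= B) ->
  Rabs (hty n c ps) <= K * B.
Proof.
  induction n as [|m [K [HK IH]]].
  - exists 0. split; [lra|]. intros c ps B _ _. cbn. rewrite Rabs_R0. lra.
  - destruct (F_bound (S m)) as [K1 [HK1 B1]]. destruct (G_bound (S m)) as [K2 [HK2 B2]].
    exists (K2 + K1 + INR (S m) * K). split.
    { assert (0 <= INR (S m) * K) by (apply Rmult_le_pos; [apply pos_INR|lra]). lra. }
    intros c [|p ps] B Hs E; [discriminate|]. cbn [hty].
    assert (Ecv : forall t l, length t = S m -> incl l (p :: ps) ->
      incl t (map fst l ++ map snd l) -> Rabs (c (fst p :: t)) <= B).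
    { intros t l Ht Il It. apply E; [cbn; lia|]. apply incl_cons; [now left|].
      eapply incl_tran; [exact It|]. apply incl_app.
      - apply incl_appl, incl_map, Il.
      - apply incl_appr, incl_map, Il. }
    pose proof (B1 (fun t => c (fst p :: t)) (p :: ps) B Hs
      (fun t Ht It => Ecv t _ Ht (incl_refl _) It)).
    pose proof (B2 (fun t => c (fst p :: t)) (p :: ps) B Hs
      (fun t Ht It => Ecv t _ Ht (incl_refl _) It)).
    assert (Rabs (dl (hty m (fun t => c (fst p :: t))) (p :: ps)) <= INR (S m) * (K * B)).
    { rewrite <- Hs. apply dl_bound. intros t Ht It. apply IH; [lia|].
      intros r Hr Ir. now apply Ecv with t. }
    unfold Rminus. eapply Rle_trans; [apply Rabs_triang|]. rewrite Rabs_Ropp.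
    eapply Rle_trans; [apply Rplus_le_compat_r, Rabs_triang|]. rewrite Rabs_Ropp. lra.
Qed.

Hypothesis F_int : forall n c ps, (forall t, is_int (c t)) -> is_int (F n c ps).
Hypothesis G_int : forall n c ps, (forall t, is_int (c t)) -> is_int (G n c ps).

Lemma hty_int n : forall c ps, (forall t, is_int (c t)) -> is_int (hty n c ps).
Proof.
  induction n as [|m IH]; intros c [|p ps] E; cbn [hty]; auto using is_int_0.
  repeat apply is_int_minus; auto. apply dl_int. intros t; apply IH; auto.
Qed.

Lemma hty_cocycle m c ps : length ps = S m ->
  (forall t, length t = S (S m) -> incl t (map fst ps ++ map snd ps) -> dl c t = 0) ->
  dl (hty m c) ps = G (S m) c ps - F (S m) c ps.
Proof.
  intros Hs E. rewrite <- hty_dl by assumption. cbn [pred].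
  (* The bound with [B = 0] removes the homotopy term of [dl c], which vanishes on all tuples that
     this term can see. *)
  destruct (hty_bound (S m)) as [K [HK HB]].
  assert (H : Rabs (hty (S m) (dl c) ps) <= K * 0).
  { apply HB; auto. intros t Ht It. rewrite E, Rabs_R0; auto. lra. }
  assert (H1 : hty (S m) (dl c) ps = 0).
  { revert H. unfold Rabs. destruct Rcase_abs; lra. }
  rewrite H1. ring.
Qed.

End Homotopy.

(** * Prism operators *)

Definition phi1 {Q : Type} n (c : list Q -> R) (ps : list (Q * Q)) := phi n c (map fst ps).
Definition phi2 {Q : Type} n (c : list Q -> R) (ps : list (Q * Q)) := phi n c (map snd ps).
Definition ident1 {Q : Type} (n : nat) (c : list Q -> R) (ps : list (Q * Q)) := c (map fst ps).
(** [step] compares the normalised cochains on two images of a tuple, while [start] passes from a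
    cochain to its normalisation. *)
Definition step {Q : Type} := @hty Q phi1 phi2.
Definition start {Q : Type} := @hty Q ident1 phi2.

Section Operators.
Context {Q : Type}.
Implicit Types (c u v : list Q -> R) (ps : list (Q * Q)).

Lemma phi_map_dl {A : Type} (f : A -> Q) m c s : length s = S m ->
  phi (S m) (dl c) (map f s) = dl (fun t => phi m c (map f t)) s.
Proof. intros Hs. rewrite phi_dl by now rewrite length_map. apply dl_map. Qed.

Lemma phi_map_bound (f : Q * Q -> Q) (Hf : f = fst \/ f = snd) n :
  exists K, 0 <= K /\ forall c ps B, length ps = n ->
  (forall t, length t = n -> incl t (map fst ps ++ map snd ps) -> Rabs (c t) <= B) ->
  Rabs (phi n c (map f ps)) <= K * B.
Proof.
  destruct (phi_bound (Q := Q) n) as [K [HK H]]. exists K. split; [exact HK|].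
  intros c ps B Hs E. apply H; [now rewrite length_map|].
  intros t Ht It. apply E; [exact Ht|]. eapply incl_tran; [exact It|].
  destruct Hf as [-> | ->]; [apply incl_appl|apply incl_appr]; apply incl_refl.
Qed.

Lemma step_cocycle m c ps : length ps = S m ->
  (forall t, length t = S (S m) -> incl t (map fst ps ++ map snd ps) -> dl c t = 0) ->
  dl (step m c) ps = phi (S m) c (map snd ps) - phi (S m) c (map fst ps).
Proof.
  intros Hs E. apply (hty_cocycle phi1 phi2); auto; unfold phi1, phi2; intros.
  - apply phi_lin.
  - apply phi_lin.
  - apply (phi_map_dl fst); assumption.
  - apply (phi_map_dl snd); assumption.
  - apply phi_map_bound; auto.
  - apply phi_map_bound; auto.
Qed.

Lemma start_cocycle m c ps : length ps = S m ->
  (forall t, length t = S (S m) -> incl t (map fst ps ++ map snd ps) -> dl c t = 0) ->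
  dl (start m c) ps = phi (S m) c (map snd ps) - c (map fst ps).
Proof.
  intros Hs E. apply (hty_cocycle ident1 phi2); auto; unfold ident1, phi2; intros.
  - apply phi_lin.
  - apply dl_map.
  - apply (phi_map_dl snd); assumption.
  - exists 1. split; [lra|]. intros. rewrite Rmult_1_l. apply H0.
    + now rewrite length_map.
    + apply incl_appl, incl_refl.
  - apply phi_map_bound; auto.
Qed.

Lemma step_bound n : exists K, 0 <= K /\ forall c ps B, length ps = n ->
  (forall t, length t = S n -> Rabs (c t) <= B) -> Rabs (step n c ps) <= K * B.
Proof.
  assert (H : exists K, 0 <= K /\ forall c ps B, length ps = n ->
    (forall t, length t = S n -> incl t (map fst ps ++ map snd ps) -> Rabs (c t) <= B) ->
    Rabs (step n c ps) <= K * B).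
  { apply hty_bound; intros; apply phi_map_bound; auto. }
  destruct H as [K [HK H]]. exists K. split; auto.
Qed.

Lemma start_bound n : exists K, 0 <= K /\ forall c ps B, length ps = n ->
  (forall t, length t = S n -> Rabs (c t) <= B) -> Rabs (start n c ps) <= K * B.
Proof.
  assert (H : exists K, 0 <= K /\ forall c ps B, length ps = n ->
    (forall t, length t = S n -> incl t (map fst ps ++ map snd ps) -> Rabs (c t) <= B) ->
    Rabs (start n c ps) <= K * B).
  { apply hty_bound; intros; [|apply phi_map_bound; auto].
    exists 1. split; [lra|]. intros c ps B Hs E. rewrite Rmult_1_l. apply E.
    - now rewrite length_map.
    - apply incl_appl, incl_refl. }
  destruct H as [K [HK H]]. exists K. split; auto.
Qed.

Lemma step_int n c ps : (forall t, is_int (c t)) -> is_int (step n c ps).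
Proof. intros. apply hty_int; auto; intros; now apply phi_int. Qed.

Lemma start_int n c ps : (forall t, is_int (c t)) -> is_int (start n c ps).
Proof. intros. apply hty_int; auto; intros; [unfold ident1; auto|now apply phi_int]. Qed.

(** A constant list of pairs is a prism over a point, hence degenerate once it has two vertices. A
    single pair [(a, b)] gives [c [a; b] - c [a; a]] instead, which has no reason to vanish; the
    restriction on the degree comes from here. *)
Lemma step_repeat m : forall c p, step (S (S m)) c (repeat p (S (S m))) = 0.
Proof.
  assert (E : forall (f : Q * Q -> Q) m c p, phi (S (S m)) c (map f (repeat p (S (S m)))) = 0).
  { intros. rewrite map_repeat. apply phi_repeat. }
  induction m as [|m IH]; intros c p.
  - unfold step. change (repeat p 2) with [p; p]. cbn. ring.
  - change (phi2 (S (S (S m))) (fun t => c (fst p :: t)) (repeat p (S (S (S m))))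
      - phi1 (S (S (S m))) (fun t => c (fst p :: t)) (repeat p (S (S (S m))))
      - dl (step (S (S m)) (fun t => c (fst p :: t))) (repeat p (S (S (S m)))) = 0).
    unfold phi1, phi2. rewrite !E, dl_repeat; [ring|]. left. apply IH.
Qed.

Lemma step_diag n : forall c ps, (forall p, In p ps -> fst p = snd p) -> step n c ps = 0.
Proof.
  induction n as [|m IH]; intros c [|p ps] E; try reflexivity.
  change (phi2 (S m) (fun t => c (fst p :: t)) (p :: ps)
      - phi1 (S m) (fun t => c (fst p :: t)) (p :: ps)
      - dl (step m (fun t => c (fst p :: t))) (p :: ps) = 0).
  unfold phi1, phi2. rewrite (map_ext_in fst snd (p :: ps) E), dl_zero; [ring|].
  intros t _ It. apply IH. intros; apply E, It; assumption.
Qed.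

End Operators.

(** * Ultrafilter limits *)

(** Ultrafilters serve twice: on the natural numbers, for the limit of the averaged primitives, and
    on the space itself, for the compactness of [h0pt]. *)
Record ultra {T : Type} (U : (T -> Prop) -> Prop) : Prop := {
  ultra_T : U (fun _ => True);
  ultra_I : forall A B : T -> Prop, U A -> U B -> U (fun x => A x /\ B x);
  ultra_S : forall A B : T -> Prop, (forall x, A x -> B x) -> U A -> U B;
  ultra_0 : ~ U (fun _ => False);
  ultra_C : forall A : T -> Prop, U A \/ U (fun x => ~ A x)
}.

Lemma ultra_extend {T : Type} (base : (T -> Prop) -> Prop) :
  (exists A, base A) ->
  (forall A B, base A -> base B -> exists C, base C /\ forall x, C x -> A x /\ B x) ->
  (forall A, base A -> exists x, A x) ->
  exists U, ultra U /\ forall A, base A -> U A.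
Proof.
  intros [A0 H0] HI Hne.
  set (F := fun A : T -> Prop => exists B, base B /\ forall x, B x -> A x).
  assert (PF : @filter.ProperFilter T F).
  { constructor.
    - intros [B [HB E]]. destruct (Hne B HB) as [x Hx]. exact (E x Hx).
    - constructor.
      + exists A0. split; [exact H0|]. intros; exact I.
      + intros A B [A' [HA EA]] [B' [HB EB]]. destruct (HI A' B' HA HB) as [C [HC EC]].
        exists C. split; [exact HC|]. intros x Hx. destruct (EC x Hx).
        split; auto.
      + intros A B S [A' [HA EA]]. exists A'. split; [exact HA|]. intros x Hx. apply S, EA, Hx. }
  destruct (filter.ultraFilterLemma PF) as [G [UG SG]].
  exists G. split.
  - pose proof (@filter.ultra_proper T G UG) as PG.
    pose proof (@filter.filter_filter T G PG) as FG.
    constructor.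
    + exact (@filter.filterT T G FG).
    + intros A B HA HB. exact (@filter.filterI T G FG A B HA HB).
    + intros A B S HA. exact (@filter.filterS T G FG A B S HA).
    + exact (@filter.filter_not_empty T G PG).
    + intros A. exact (filter.in_ultra_setVsetC A UG).
  - intros A HA. apply SG. exists A. auto.
Qed.

Section Limits.
Context {T : Type} (U : (T -> Prop) -> Prop) (HU : ultra U).
Implicit Types s : T -> R.

Definition ulim s (l : R) := forall eps, 0 < eps -> U (fun x => Rabs (s x - l) < eps).

Lemma ultra_ex A : U A -> exists x, A x.
Proof.
  intros HA. apply NNPP. intros N. apply (ultra_0 U HU).
  apply (ultra_S U HU A); [|exact HA]. intros x Hx. apply N. now exists x.
Qed.

Lemma ulim_lin a b s s' l l' : ulim s l -> ulim s' l' ->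
  ulim (fun x => a * s x + b * s' x) (a * l + b * l').
Proof.
  intros H H' eps He. set (K := Rabs a + Rabs b + 1).
  assert (HK : 0 < K) by (pose proof (Rabs_pos a); pose proof (Rabs_pos b); unfold K; lra).
  assert (He' : 0 < eps / K) by (apply Rdiv_lt_0_compat; lra).
  apply (ultra_S U HU (fun x => Rabs (s x - l) < eps / K /\ Rabs (s' x - l') < eps / K)).
  2:{ apply ultra_I; auto. }
  intros x [Hx Hx'].
  replace (a * s x + b * s' x - (a * l + b * l')) with (a * (s x - l) + b * (s' x - l')) by ring.
  eapply Rle_lt_trans; [apply Rabs_triang|]. rewrite !Rabs_mult.
  assert (Rabs a * Rabs (s x - l) <= Rabs a * (eps / K)) by (apply Rmult_le_compat_l; [apply Rabs_pos|lra]).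
  assert (Rabs b * Rabs (s' x - l') <= Rabs b * (eps / K)) by (apply Rmult_le_compat_l; [apply Rabs_pos|lra]).
  assert (E : eps = (Rabs a + Rabs b + 1) * (eps / K)) by (fold K; field; lra).
  lra.
Qed.

Lemma ulim_eventually s s' l : U (fun x => s x = s' x) -> ulim s l -> ulim s' l.
Proof.
  intros E H eps He. apply (ultra_S U HU (fun x => s x = s' x /\ Rabs (s x - l) < eps)).
  - intros x [<- Hx]; exact Hx.
  - apply ultra_I; auto.
Qed.

Lemma ulim_const l : ulim (fun _ => l) l.
Proof.
  intros eps He. apply (ultra_S U HU (fun _ => True)); [|apply ultra_T, HU].
  intros _ _. rewrite Rminus_diag, Rabs_R0. exact He.
Qed.

Lemma ulim_unique s l l' : ulim s l -> ulim s l' -> l = l'.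
Proof.
  intros H H'. destruct (Req_dec l l') as [|N]; [assumption|exfalso].
  assert (He : 0 < Rabs (l - l') / 2) by (assert (0 < Rabs (l - l')) by (apply Rabs_pos_lt; lra); lra).
  destruct (ultra_ex _ (ultra_I U HU _ _ (H _ He) (H' _ He))) as [x [Hx Hx']].
  revert Hx Hx'. unfold Rabs. repeat destruct Rcase_abs; lra.
Qed.

Lemma ulim_bound s l B : (forall x, Rabs (s x) <= B) -> ulim s l -> Rabs l <= B.
Proof.
  intros Hs H. apply Rnot_lt_le. intros N.
  destruct (ultra_ex _ (H (Rabs l - B) ltac:(lra))) as [x Hx]. specialize (Hs x).
  revert N Hx Hs. unfold Rabs. repeat destruct Rcase_abs; lra.
Qed.

Lemma ulim_exists s B : (forall x, Rabs (s x) <= B) -> exists l, ulim s l.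
Proof.
  intros Hs.
  assert (Hb : forall x, - B <= s x <= B)
    by (intros x; specialize (Hs x); revert Hs; unfold Rabs; destruct Rcase_abs; lra).
  (* The limit is the supremum of the numbers below which [s] does not fall on a set of [U]. *)
  destruct (completeness (fun r => U (fun x => r <= s x))) as [l [Hl Hl']].
  - exists B. intros r Hr. destruct (ultra_ex _ Hr) as [x Hx]. specialize (Hb x). lra.
  - exists (- B). apply (ultra_S U HU (fun _ => True)); [|apply ultra_T, HU].
    intros x _. apply Hb.
  - exists l. intros eps He.
    assert (HA : U (fun x => l - eps / 2 <= s x)).
    { apply NNPP. intros N. assert (l <= l - eps / 2); [|lra]. apply Hl'. intros r Hr.
      apply Rnot_lt_le. intros Nr. apply N.
      apply (ultra_S U HU (fun x => r <= s x)); [intros; lra|exact Hr]. }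
    assert (HB : U (fun x => ~ (l + eps / 2 <= s x))).
    { destruct (ultra_C U HU (fun x => l + eps / 2 <= s x)) as [H|H]; [|exact H].
      apply Hl in H. lra. }
    apply (ultra_S U HU (fun x => l - eps / 2 <= s x /\ ~ (l + eps / 2 <= s x))).
    + intros x [H1 H2]. apply Rnot_le_lt in H2. apply Rabs_def1; lra.
    + apply ultra_I; auto.
Qed.

Lemma ulim_dl {Q : Type} (v : T -> list Q -> R) (w : list Q -> R) t :
  (forall r, S (length r) = length t -> incl r t -> ulim (fun x => v x r) (w r)) ->
  ulim (fun x => dl (v x) t) (dl w t).
Proof.
  revert v w. induction t as [|q t IH]; intros v w H; cbn [dl].
  - apply ulim_const.
  - replace (w t - dl (fun r => w (q :: r)) t) with (1 * w t + (-1) * dl (fun r => w (q :: r)) t) by ring.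
    apply (ulim_eventually (fun x => 1 * v x t + (-1) * dl (fun r => v x (q :: r)) t)).
    + apply (ultra_S U HU (fun _ => True)); [intros; ring|apply ultra_T, HU].
    + apply ulim_lin.
      * apply H; [reflexivity|apply incl_tl, incl_refl].
      * apply IH. intros r Hr Ir. apply H; [cbn; lia|].
        apply incl_cons; [now left|now apply incl_tl].
Qed.

End Limits.

Lemma ultra_nat : exists U : (nat -> Prop) -> Prop,
  ultra U /\ forall m, U (fun N => (m <= N)%nat).
Proof.
  destruct (ultra_extend (fun A => exists m, A = fun N => (m <= N)%nat)) as [U [HU H]].
  - exists (fun N => (0 <= N)%nat). now exists 0%nat.
  - intros A B [m ->] [m' ->]. exists (fun N => (Nat.max m m' <= N)%nat).
    split; [now eexists|]. intros; lia.
  - intros A [m ->]. now exists m.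
  - exists U. split; [exact HU|]. intros m. apply H. now exists m.
Qed.

(** * Finite sums *)

Section Sums.
Context {A : Type}.
Implicit Types (f g : A -> R) (l : list A).

Definition lsum f l : R := fold_right (fun a r => f a + r) 0 l.

Lemma lsum_app f l l' : lsum f (l ++ l') = lsum f l + lsum f l'.
Proof. unfold lsum. induction l as [|a l IH]; cbn; [ring|]. rewrite IH. ring. Qed.

Lemma lsum_ext f g l : (forall a, In a l -> f a = g a) -> lsum f l = lsum g l.
Proof.
  unfold lsum. induction l as [|a l IH]; intros E; cbn; [reflexivity|].
  rewrite E, IH; auto; [intros; apply E; now right|now left].
Qed.

Lemma lsum_le f g l : (forall a, In a l -> f a <= g a) -> lsum f l <= lsum g l.
Proof.
  unfold lsum. induction l as [|a l IH]; intros E; cbn; [lra|].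
  apply Rplus_le_compat; [apply E; now left|apply IH; intros; apply E; now right].
Qed.

Lemma lsum_lin x y f g l :
  lsum (fun a => x * f a + y * g a) l = x * lsum f l + y * lsum g l.
Proof. unfold lsum. induction l as [|a l IH]; cbn; [ring|]. rewrite IH. ring. Qed.

Lemma lsum_const x l : lsum (fun _ => x) l = INR (length l) * x.
Proof.
  unfold lsum. induction l as [|a l IH]; [cbn; ring|].
  cbn [fold_right length]. rewrite IH, S_INR. ring.
Qed.

Lemma lsum_abs f l : Rabs (lsum f l) <= lsum (fun a => Rabs (f a)) l.
Proof.
  unfold lsum. induction l as [|a l IH]; cbn; [rewrite Rabs_R0; lra|].
  eapply Rle_trans; [apply Rabs_triang|lra].
Qed.

Lemma lsum_pos f l : (forall a, In a l -> 0 <= f a) -> 0 <= lsum f l.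
Proof.
  intros E. replace 0 with (lsum (fun _ => 0) l) by (rewrite lsum_const; ring).
  now apply lsum_le.
Qed.

Lemma lsum_ge f l b : (forall a, In a l -> 0 <= f a) -> In b l -> f b <= lsum f l.
Proof.
  induction l as [|a l IH]; intros E [].
  - subst. cbn. fold (lsum f l). assert (0 <= lsum f l) by (apply lsum_pos; intros; apply E; now right). lra.
  - cbn. fold (lsum f l). assert (0 <= f a) by (apply E; now left).
    assert (f b <= lsum f l) by (apply IH; auto; intros; apply E; now right). lra.
Qed.

Lemma lsum_int f l : (forall a, is_int (f a)) -> is_int (lsum f l).
Proof.
  intros E. induction l as [|a l [z Hz]]; [apply is_int_0|].
  cbn. fold (lsum f l). destruct (E a) as [x Hx]. exists (x + z)%Z.
  now rewrite plus_IZR, Hx, Hz.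
Qed.

End Sums.

Lemma lsum_swap {A B : Type} (f : A -> B -> R) l l' :
  lsum (fun a => lsum (f a) l') l = lsum (fun b => lsum (fun a => f a b) l) l'.
Proof.
  induction l as [|a l IH].
  - change (0 = lsum (fun _ => 0) l'). rewrite lsum_const. ring.
  - cbn. fold (lsum (fun a => lsum (f a) l') l). rewrite IH.
    transitivity (lsum (fun b => 1 * f a b + 1 * lsum (fun a => f a b) l) l').
    + rewrite (lsum_lin 1 1 (f a)). ring.
    + apply lsum_ext. intros b _. unfold lsum. ring.
Qed.

Lemma dl_lsum {A Q : Type} (v : A -> list Q -> R) l : forall s,
  dl (fun t => lsum (fun a => v a t) l) s = lsum (fun a => dl (v a) s) l.
Proof.
  induction l as [|a l IH]; intros s.
  - apply dl_zero. reflexivity.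
  - cbn. fold (lsum (fun a => dl (v a) s) l). rewrite <- IH.
    rewrite (dl_ext s _ (fun t => 1 * v a t + 1 * lsum (fun a => v a t) l)).
    + rewrite dl_lin. ring.
    + intros t _ _. cbn. unfold lsum. ring.
Qed.

Lemma lsum_telescope (f : nat -> R) n : forall a,
  lsum (fun m => f m - f (S m)) (seq a n) = f a - f (a + n)%nat.
Proof.
  induction n as [|n IH]; intros a.
  - cbn. rewrite Nat.add_0_r. ring.
  - cbn [seq]. change (f a - f (S a) + lsum (fun m => f m - f (S m)) (seq (S a) n) = f a - f (a + S n)%nat).
    rewrite IH. replace (S a + n)%nat with (a + S n)%nat by lia. ring.
Qed.

(** Raising [A] by one drops the first quotient and appends the same quotient plus one, so the sum
    grows by one. *)
Lemma sum_Zdiv_shift (n : nat) (A : Z) : (0 < n)%nat ->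
  lsum (fun i => IZR ((A + Z.of_nat i) / Z.of_nat n)) (seq 0 n) = IZR A.
Proof.
  intros Hn.
  set (T := fun A => lsum (fun i => IZR ((A + Z.of_nat i) / Z.of_nat n)) (seq 0 n)).
  change (T A = IZR A).
  assert (S1 : forall A, T (A + 1)%Z = T A + 1).
  { intros B. pose proof (lsum_telescope (fun i => IZR ((B + Z.of_nat i) / Z.of_nat n)) n 0) as E.
    rewrite (lsum_ext _ (fun i => 1 * IZR ((B + Z.of_nat i) / Z.of_nat n)
      + (-1) * IZR ((B + 1 + Z.of_nat i) / Z.of_nat n))) in E.
    2:{ intros i _. replace (B + Z.of_nat (S i))%Z with (B + 1 + Z.of_nat i)%Z by lia. ring. }
    rewrite lsum_lin in E. fold (T B) in E. fold (T (B + 1)%Z) in E.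
    cbn [Nat.add] in E.
    replace (B + Z.of_nat n)%Z with (B + 1 * Z.of_nat n)%Z in E by ring.
    rewrite Z.div_add, plus_IZR in E by lia.
    replace (B + Z.of_nat 0)%Z with B in E by (cbn; lia). lra. }
  assert (T0 : T 0%Z = 0).
  { unfold T. rewrite (lsum_ext _ (fun _ => 0)); [rewrite lsum_const; ring|].
    intros i Hi. apply in_seq in Hi. rewrite Z.div_small by lia. reflexivity. }
  revert A. apply Z.peano_ind.
  - exact T0.
  - intros x Hx. unfold Z.succ. rewrite S1, plus_IZR, Hx. reflexivity.
  - intros x Hx. specialize (S1 (Z.pred x)). replace (Z.pred x + 1)%Z with x in S1 by lia.
    unfold Z.pred in *. rewrite plus_IZR. rewrite Hx in S1. lra.
Qed.

(** Hermite's identity. Each summand depends only on the integer part of [n a], which reduces it to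
    integer numerators. *)
Lemma hermite_identity (n : nat) (a : R) : (0 < n)%nat ->
  lsum (fun i => IZR (Int_part (a + INR i / INR n))) (seq 0 n) = IZR (Int_part (INR n * a)).
Proof.
  intros Hn. rewrite <- (sum_Zdiv_shift n) by assumption. apply lsum_ext. intros i _. f_equal.
  symmetry. apply Int_part_spec.
  destruct (base_Int_part (INR n * a)) as [H1 H2]. set (A := Int_part (INR n * a)) in *.
  assert (Hn' : 0 < INR n) by (apply lt_0_INR; lia).
  pose proof (Z.div_mod (A + Z.of_nat i) (Z.of_nat n) ltac:(lia)) as E.
  pose proof (Z.mod_pos_bound (A + Z.of_nat i) (Z.of_nat n) ltac:(lia)) as B.
  set (q := ((A + Z.of_nat i) / Z.of_nat n)%Z) in *.
  assert (E1 : IZR q * INR n <= IZR A + INR i).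
  { rewrite !INR_IZR_INZ, <- mult_IZR, <- plus_IZR. apply IZR_le. lia. }
  assert (E2 : IZR A + INR i + 1 <= IZR q * INR n + INR n).
  { rewrite !INR_IZR_INZ, <- mult_IZR, <- !plus_IZR. apply IZR_le. lia. }
  assert (X : (a + INR i / INR n) * INR n = INR n * a + INR i) by (field; lra).
  split.
  - apply Rmult_lt_reg_r with (INR n); [exact Hn'|]. rewrite Rmult_minus_distr_r, X. lra.
  - apply Rmult_le_reg_r with (INR n); [exact Hn'|]. rewrite X. lra.
Qed.

Lemma Int_part_mono a b : a <= b -> (Int_part a <= Int_part b)%Z.
Proof.
  intros H. destruct (base_Int_part a), (base_Int_part b).
  apply Zlt_succ_le, lt_IZR. unfold Z.succ. rewrite plus_IZR. lra.
Qed.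

(** The floor is monotone, so all differences have the same sign and the sum is a difference of two
    Hermite sums. It counts, over all shifts, the grid walls between [a] and [b]; the summand [1] is
    the error of taking finitely many shifts. *)
Lemma sum_Int_part_diff (n : nat) (a b : R) : (0 < n)%nat ->
  lsum (fun i => Rabs (IZR (Int_part (a + INR i / INR n)) - IZR (Int_part (b + INR i / INR n)))) (seq 0 n)
  <= INR n * Rabs (a - b) + 1.
Proof.
  intros Hn.
  assert (W : forall a b, a <= b ->
    lsum (fun i => Rabs (IZR (Int_part (a + INR i / INR n)) - IZR (Int_part (b + INR i / INR n)))) (seq 0 n)
    <= INR n * (b - a) + 1).
  { clear a b. intros a b H.
    rewrite (lsum_ext _ (fun i => 1 * IZR (Int_part (b + INR i / INR n)) + (-1) * IZR (Int_part (a + INR i / INR n)))).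
    - rewrite lsum_lin, !hermite_identity by assumption.
      destruct (base_Int_part (INR n * a)), (base_Int_part (INR n * b)). lra.
    - intros i _. rewrite Rabs_left1; [ring|].
      pose proof (IZR_le _ _ (Int_part_mono (a + INR i / INR n) (b + INR i / INR n) ltac:(lra))). lra. }
  destruct (Rle_dec a b).
  - rewrite Rabs_left1 by lra. specialize (W a b r). lra.
  - rewrite Rabs_right by lra. rewrite (lsum_ext _ (fun i => Rabs (IZR (Int_part (b + INR i / INR n)) - IZR (Int_part (a + INR i / INR n))))).
    + specialize (W b a ltac:(lra)). lra.
    + intros; apply Rabs_minus_sym.
Qed.

(** * The upward flow on small tuples *)

Lemma Rabs_le_elim x a : Rabs x <= a -> - a <= x <= a.
Proof. unfold Rabs. destruct Rcase_abs; lra. Qed.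

Definition pt : Type := ((nat -> R) * R)%type.

Section Model.
Variable h : nat.

(* [pt] records the horizontal coordinates (only the first [h] matter) and the logarithm of the
   height of a point of the upper half-space. *)
Definition close (rho : R) (p q : pt) : Prop :=
  Rabs (snd p - snd q) <= rho /\
  forall m, (m < h)%nat -> Rabs (fst p m - fst q m) <= rho * exp (snd p).

Definition small (rho : R) (s : list pt) : Prop :=
  forall p q, In p s -> In q s -> close rho p q.

Lemma small_incl rho s t : incl t s -> small rho s -> small rho t.
Proof. intros I S p q Hp Hq. apply S; auto. Qed.

Lemma close_mono rho rho' p q : rho <= rho' -> close rho p q -> close rho' p q.
Proof.
  intros H [H1 H2]. split; [lra|]. intros m Hm. specialize (H2 m Hm).
  pose proof (exp_pos (snd p)).
  assert (rho * exp (snd p) <= rho' * exp (snd p)) by (apply Rmult_le_compat_r; lra). lra.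
Qed.

Lemma small_mono rho rho' s : rho <= rho' -> small rho s -> small rho' s.
Proof. intros H S p q Hp Hq. apply close_mono with rho; auto. Qed.

Lemma close_refl rho p : 0 <= rho -> close rho p p.
Proof.
  intros H. pose proof (exp_pos (snd p)). split.
  - rewrite Rminus_diag, Rabs_R0. exact H.
  - intros m _. rewrite Rminus_diag, Rabs_R0. apply Rmult_le_pos; lra.
Qed.

Variable rho : R.
Hypothesis rho_pos : 0 < rho.
Hypothesis rho_le1 : rho <= 1.

(** Both constants are dictated by [lift_close]. In height, [rho / 2] from the tuple and [del] from
    one level add up to [rho]. Horizontally the two roundings cost [kap] and, since [exp 1 <= 3],
    [3 * kap], and [4 * kap + rho / 2 <= rho]. *)
Let del := rho / 2.
Let kap := rho / 12.

Definition mesh (M : Z) : R := kap * exp (del * IZR M).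

Lemma mesh_pos M : 0 < mesh M.
Proof. apply Rmult_lt_0_compat; [unfold kap; lra|apply exp_pos]. Qed.

(** The truncated flow at level [M], with the grid shifted by [theta]. Coordinates beyond [h] are
    reset to zero so that points in the same cell get literally equal images. *)
Definition lift (theta : R) (M : Z) (p : pt) : pt :=
  if Rle_dec (del * IZR M) (snd p) then p else
  (fun m => if Nat.ltb m h
            then mesh M * (IZR (Int_part (fst p m / mesh M + theta)) - theta) else 0,
   del * IZR M).

Lemma lift_high theta M p : del * IZR M <= snd p -> lift theta M p = p.
Proof. intros H. unfold lift. destruct Rle_dec; [reflexivity|contradiction]. Qed.

Lemma lift_eq theta M p q : snd p < del * IZR M -> snd q < del * IZR M ->
  (forall m, (m < h)%nat ->
    Int_part (fst p m / mesh M + theta) = Int_part (fst q m / mesh M + theta)) ->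
  lift theta M p = lift theta M q.
Proof.
  intros Hp Hq E. unfold lift. destruct Rle_dec; [lra|]. destruct Rle_dec; [lra|].
  f_equal. apply functional_extensionality. intros m.
  destruct (Nat.ltb_spec m h); [|reflexivity]. now rewrite E.
Qed.

Lemma lift_height theta M p : snd (lift theta M p) = Rmax (snd p) (del * IZR M).
Proof.
  unfold lift, Rmax. destruct (Rle_dec (del * IZR M) (snd p)), (Rle_dec (snd p) (del * IZR M)); cbn; lra.
Qed.

Lemma lift_move theta M p m : (m < h)%nat ->
  Rabs (fst (lift theta M p) m - fst p m) <= kap * exp (snd (lift theta M p)).
Proof.
  intros Hm. unfold lift. destruct Rle_dec; cbn [fst snd].
  - rewrite Rminus_diag, Rabs_R0. apply Rmult_le_pos; [unfold kap; lra|left; apply exp_pos].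
  - destruct (Nat.ltb_spec m h); [|lia]. fold (mesh M). pose proof (mesh_pos M).
    set (y := fst p m / mesh M + theta).
    replace (fst p m) with (mesh M * (y - theta)) by (unfold y; field; lra).
    destruct (base_Int_part y).
    replace (mesh M * (IZR (Int_part y) - theta) - mesh M * (y - theta))
      with (mesh M * (IZR (Int_part y) - y)) by ring.
    rewrite Rabs_mult, (Rabs_pos_eq (mesh M)) by lra.
    rewrite <- (Rmult_1_r (mesh M)) at 2. apply Rmult_le_compat_l; [lra|].
    apply Rabs_le. lra.
Qed.

Lemma lift_close theta M M' p q : Rabs (IZR M - IZR M') <= 1 ->
  close (rho / 2) p q -> close rho (lift theta M p) (lift theta M' q).
Proof.
  intros HM [Hw Hx].
  assert (HW : Rabs (snd (lift theta M p) - snd (lift theta M' q)) <= rho).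
  { rewrite !lift_height.
    assert (Rabs (del * IZR M - del * IZR M') <= del).
    { rewrite <- Rmult_minus_distr_l, Rabs_mult, (Rabs_pos_eq del) by (unfold del; lra).
      rewrite <- (Rmult_1_r del) at 2. apply Rmult_le_compat_l; [unfold del; lra|exact HM]. }
    assert (del = rho / 2) by reflexivity.
    revert Hw H. generalize (del * IZR M) (del * IZR M'). intros a b.
    unfold Rmax, Rabs. repeat destruct Rle_dec; repeat destruct Rcase_abs; lra. }
  split; [exact HW|]. intros m Hm.
  pose proof (lift_move theta M p m Hm) as H1. pose proof (lift_move theta M' q m Hm) as H2.
  specialize (Hx m Hm).
  set (P := lift theta M p) in *. set (P' := lift theta M' q) in *.
  assert (E1 : exp (snd P') <= 3 * exp (snd P)).
  { apply Rle_trans with (exp (1 + snd P)).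
    - destruct (Req_dec (snd P') (1 + snd P)) as [->|]; [lra|]. left. apply exp_increasing.
      revert HW. unfold Rabs. destruct Rcase_abs; lra.
    - rewrite exp_plus. apply Rmult_le_compat_r; [left; apply exp_pos|apply exp_le_3]. }
  assert (E2 : exp (snd p) <= exp (snd P)).
  { unfold P. rewrite lift_height. destruct (Req_dec (snd p) (Rmax (snd p) (del * IZR M))) as [<-|N]; [lra|].
    left. apply exp_increasing. pose proof (Rmax_l (snd p) (del * IZR M)). lra. }
  replace (fst P m - fst P' m) with ((fst P m - fst p m) + (fst p m - fst q m) - (fst P' m - fst q m)) by ring.
  pose proof (exp_pos (snd P)).
  assert (rho / 2 * exp (snd p) <= rho / 2 * exp (snd P)) by (apply Rmult_le_compat_l; lra).
  assert (kap * exp (snd P') <= kap * (3 * exp (snd P))) by (apply Rmult_le_compat_l; [unfold kap; lra|exact E1]).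
  assert (kap * exp (snd P) + rho / 2 * exp (snd P) + kap * (3 * exp (snd P)) <= rho * exp (snd P)).
  { replace (kap * exp (snd P) + rho / 2 * exp (snd P) + kap * (3 * exp (snd P)))
      with ((4 * kap + rho / 2) * exp (snd P)) by ring.
    apply Rmult_le_compat_r; unfold kap; lra. }
  apply Rabs_le.
  apply Rabs_le_elim in H1. apply Rabs_le_elim in H2. apply Rabs_le_elim in Hx. lra.
Qed.

(** * Telescoping over the levels of the flow *)

Definition pair_lift theta M p := (lift theta M p, lift theta (M + 1) p).

Lemma pair_lift_small theta M s : small (rho / 2) s ->
  small rho (map fst (map (pair_lift theta M) s) ++ map snd (map (pair_lift theta M) s)).
Proof.
  intros S. rewrite !map_map.
  assert (E : forall x, In x (map (fun p => fst (pair_lift theta M p)) s ++ map (fun p => snd (pair_lift theta M p)) s) ->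
    exists p M', In p s /\ x = lift theta M' p /\ (IZR M' = IZR M \/ IZR M' = IZR M + 1)).
  { intros x Hx. apply in_app_or in Hx. destruct Hx as [Hx|Hx]; apply in_map_iff in Hx;
      destruct Hx as [p [<- Hp]]; exists p.
    - exists M. auto.
    - exists (M + 1)%Z. rewrite plus_IZR. auto. }
  intros x y Hx Hy. destruct (E x Hx) as [p [M1 [Hp [-> H1]]]].
  destruct (E y Hy) as [q [M2 [Hq [-> H2]]]].
  apply lift_close; [|apply S; assumption].
  apply Rabs_le. destruct H1 as [-> | ->], H2 as [-> | ->]; lra.
Qed.

(** The range is [-N] to [N - 1]: each level is paired with its successor, so the telescope ends at
    [N]. *)
Definition levels (N : nat) : list Z := map (fun m => (Z.of_nat m - Z.of_nat N)%Z) (seq 0 (2 * N)).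

Lemma lsum_levels (f : Z -> R) N :
  lsum f (levels N) = lsum (fun m => f (Z.of_nat m - Z.of_nat N)%Z) (seq 0 (2 * N)).
Proof.
  unfold levels. induction (seq 0 (2 * N)) as [|a l IH]; [reflexivity|].
  cbn. unfold lsum in IH. now rewrite IH.
Qed.

Lemma levels_telescope (f : Z -> R) N :
  lsum (fun M => f M - f (M + 1)%Z) (levels N) = f (- Z.of_nat N)%Z - f (Z.of_nat N).
Proof.
  rewrite lsum_levels.
  rewrite (lsum_ext _ (fun m => f (Z.of_nat m - Z.of_nat N)%Z - f (Z.of_nat (S m) - Z.of_nat N)%Z)).
  - rewrite (lsum_telescope (fun m => f (Z.of_nat m - Z.of_nat N)%Z)).
    f_equal; f_equal; lia.
  - intros m _. do 2 f_equal. lia.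
Qed.

Definition diag (p : pt) := (p, p).

(** The prisms between a tuple and its image at level [N]. The homotopy formulas yield target minus
    source, hence the minus signs. *)
Definition fill theta N (c : list pt -> R) (s : list pt) : R :=
  - start (length s) c (map diag s)
  - lsum (fun M => step (length s) c (map (pair_lift theta M) s)) (levels N).

Lemma fill_dl theta N c s m : length s = S m -> small (rho / 2) s ->
  (forall p, In p s -> del * IZR (- Z.of_nat N) <= snd p) ->
  (forall t, length t = S (S m) -> small rho t -> dl c t = 0) ->
  dl (fill theta N c) s = c s - phi (S m) c (map (lift theta (Z.of_nat N)) s).
Proof.
  intros Hs Ss Hl Hc.
  rewrite (dl_ext s _ (fun t => (-1) * start m c (map diag t)
     + (-1) * lsum (fun M => step m c (map (pair_lift theta M) t)) (levels N))).
  2:{ intros t Ht _. unfold fill. replace (length t) with m by lia. ring. }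
  rewrite dl_lin, <- (dl_map diag s (start m c)).
  rewrite (dl_lsum (fun M t => step m c (map (pair_lift theta M) t))).
  rewrite start_cocycle.
  2:{ now rewrite length_map. }
  2:{ intros t Ht It. apply Hc; [exact Ht|]. apply small_incl with s.
      - rewrite !map_map, !map_id in It. intros x Hx. destruct (in_app_or _ _ _ (It x Hx)); assumption.
      - apply small_mono with (rho / 2); [lra|exact Ss]. }
  rewrite (lsum_ext _ (fun M => phi (S m) c (map (lift theta (M + 1)) s) - phi (S m) c (map (lift theta M) s))).
  2:{ intros M _. rewrite <- (dl_map (pair_lift theta M) s (step m c)), step_cocycle.
      - rewrite !map_map. reflexivity.
      - now rewrite length_map.
      - intros t Ht It. apply Hc; [exact Ht|]. eapply small_incl; [exact It|].
        now apply pair_lift_small. }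
  rewrite (lsum_ext _ (fun M => (-1) * (phi (S m) c (map (lift theta M) s) - phi (S m) c (map (lift theta (M + 1)) s)) + 0 * 0))
    by (intros; ring).
  rewrite lsum_lin, (levels_telescope (fun M => phi (S m) c (map (lift theta M) s))).
  rewrite !map_map. cbn [diag fst snd]. rewrite map_id.
  (* Level [-N] lies below the tuple and does not move it, so the lower end of the telescope cancels
     against the end of [start]. *)
  rewrite (map_ext_in (lift theta (- Z.of_nat N)) (fun p => p) s), map_id by (intros; apply lift_high; auto).
  ring.
Qed.

(** * The integral primitive from a fixed grid *)

Lemma coord_bound (p : pt) : exists X, 0 <= X /\ forall m, (m < h)%nat -> Rabs (fst p m) <= X.
Proof.
  induction h as [|h' [X [HX IH]]].
  - exists 0. split; [lra|]. intros; lia.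
  - exists (Rmax X (Rabs (fst p h'))). split; [apply Rle_trans with X; [exact HX|apply Rmax_l]|].
    intros m Hm. destruct (Nat.eq_dec m h') as [->|].
    + apply Rmax_r.
    + apply Rle_trans with X; [apply IH; lia|apply Rmax_l].
Qed.

Lemma mesh_large M : kap * (1 + del * IZR M) <= mesh M.
Proof.
  apply Rmult_le_compat_l; [unfold kap; lra|].
  destruct (Req_dec (del * IZR M) 0) as [->|E]; [rewrite exp_0; lra|].
  left. now apply exp_ineq1.
Qed.

Definition origin : pt := (fun _ => 0, 0).

Lemma lift_origin p : exists N0 : nat, forall M : Z,
  ((Z.of_nat N0 <= M)%Z -> lift (1 / 2) M p = lift (1 / 2) M origin) /\
  ((M <= - Z.of_nat N0)%Z -> del * IZR (M + 1) <= snd p).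
Proof.
  destruct (coord_bound p) as [X [HX0 HX]].
  assert (Hd : 0 < del) by (unfold del; lra). assert (Hk : 0 < kap) by (unfold kap; lra).
  (* The first entry puts the height of [p] between the levels [-N0] and [N0] with one level to
     spare. The second makes the mesh exceed [2 * X]; with shift [1 / 2] the origin is the centre of
     its cell, so [p] lies in that cell. *)
  set (A := Rmax (1 + Rabs (snd p) / del) (2 * X / (kap * del))).
  destruct (INR_unbounded A) as [N0 HN]. exists N0.
  assert (H1 : 1 + Rabs (snd p) / del <= A) by apply Rmax_l.
  assert (H2 : 2 * X / (kap * del) <= A) by apply Rmax_r.
  assert (H3 : Rabs (snd p) < del * (INR N0 - 1)).
  { replace (Rabs (snd p)) with (del * (Rabs (snd p) / del)) by (field; lra).
    apply Rmult_lt_compat_l; lra. }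
  assert (H4 : 2 * X < kap * del * INR N0).
  { replace (2 * X) with (kap * del * (2 * X / (kap * del))) by (field; lra).
    apply Rmult_lt_compat_l; [nra|lra]. }
  intros M. split; intros HM.
  - apply IZR_le in HM. rewrite <- INR_IZR_INZ in HM.
    assert (H5 : del * INR N0 <= del * IZR M) by (apply Rmult_le_compat_l; lra).
    pose proof (Rabs_pos (snd p)). pose proof (Rle_abs (snd p)).
    apply lift_eq; [lra|cbn; lra|].
    pose proof (mesh_pos M). pose proof (mesh_large M).
    assert (K7 : 2 * X < mesh M).
    { assert (kap * (del * INR N0) <= kap * (del * IZR M)) by (apply Rmult_le_compat_l; lra). lra. }
    intros m Hm. cbn [origin fst].
    transitivity 0%Z; [symmetry|]; apply Int_part_spec; [|split; lra].
    specialize (HX m Hm).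
    assert (K8 : Rabs (fst p m / mesh M) < 1 / 2).
    { unfold Rdiv. rewrite Rabs_mult, Rabs_inv, (Rabs_pos_eq (mesh M)) by lra.
      apply Rmult_lt_reg_r with (mesh M); [lra|]. rewrite Rmult_assoc, Rinv_l by lra. lra. }
    apply Rabs_def2 in K8. lra.
  - apply IZR_le in HM. rewrite opp_IZR, <- INR_IZR_INZ in HM. rewrite plus_IZR.
    assert (del * (IZR M + 1) <= del * (1 - INR N0)) by (apply Rmult_le_compat_l; lra).
    pose proof (Rle_abs (- snd p)) as K0. rewrite Rabs_Ropp in K0. lra.
Qed.

Lemma lift_origin_list s : exists N0 : nat, forall p, In p s -> forall M : Z,
  ((Z.of_nat N0 <= M)%Z -> lift (1 / 2) M p = lift (1 / 2) M origin) /\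
  ((M <= - Z.of_nat N0)%Z -> del * IZR (M + 1) <= snd p).
Proof.
  induction s as [|q s [N IH]].
  - exists 0%nat. intros p [].
  - destruct (lift_origin q) as [N' H']. exists (Nat.max N N').
    intros p [<-|Hp] M; [destruct (H' M)|destruct (IH p Hp M)]; split; intros; auto with zarith.
Qed.

(* On vertices the sum over the levels diverges; subtracting the path of a base point makes it
   eventually constant without changing the coboundary. *)
Definition rfill N (c : list pt -> R) (s : list pt) : R :=
  fill (1 / 2) N c s
  + lsum (fun M => step (length s) c (map (fun _ => pair_lift (1 / 2) M origin) s)) (levels N).

(** At level [N] all vertices share the image of the origin, and [phi] vanishes on constant tuples
    with at least two vertices. For the same reason the correction along the base path has zero
    coboundary. *)
Lemma rfill_dl N c s m : length s = S (S m) -> small (rho / 2) s ->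
  (forall p, In p s -> del * IZR (- Z.of_nat N) <= snd p) ->
  (forall p, In p s -> lift (1 / 2) (Z.of_nat N) p = lift (1 / 2) (Z.of_nat N) origin) ->
  (forall t, length t = S (S (S m)) -> small rho t -> dl c t = 0) ->
  dl (rfill N c) s = c s.
Proof.
  intros Hs Ss Hl Ho Hc.
  rewrite (dl_ext s _ (fun t => 1 * fill (1 / 2) N c t
     + 1 * lsum (fun M => step (S m) c (map (fun _ => pair_lift (1 / 2) M origin) t)) (levels N))).
  2:{ intros t Ht _. unfold rfill. replace (length t) with (S m) by lia. ring. }
  rewrite dl_lin, (fill_dl _ _ _ _ (S m)) by assumption.
  assert (R0 : forall (A : Type) (q : A), map (fun _ : pt => q) s = repeat q (S (S m)))
    by (intros A q; now rewrite map_const, Hs).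
  rewrite (map_ext_in _ _ s Ho), R0, phi_repeat.
  rewrite (dl_lsum (fun M t => step (S m) c (map (fun _ => pair_lift (1 / 2) M origin) t))).
  rewrite (lsum_ext _ (fun _ => 0)); [rewrite lsum_const; ring|].
  intros M _. rewrite <- (dl_map (fun _ => pair_lift (1 / 2) M origin) s (step (S m) c)), step_cocycle.
  - rewrite !map_map, !R0, !phi_repeat. ring.
  - now rewrite length_map.
  - intros t Ht It. apply Hc; [exact Ht|].
    assert (S0 : small rho (map fst (map (pair_lift (1/2) M) [origin]) ++ map snd (map (pair_lift (1/2) M) [origin]))).
    { apply pair_lift_small. intros p q [<-|[]] [<-|[]]. apply close_refl. lra. }
    eapply small_incl; [|exact S0]. intros x Hx. specialize (It x Hx). rewrite !map_map in It.
    apply in_app_or in It. cbn.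
    destruct It as [It|It]; apply in_map_iff in It; destruct It as [_ [<- _]]; auto.
Qed.

Lemma levels_S (f : Z -> R) N :
  lsum f (levels (S N)) = f (- Z.of_nat (S N))%Z + lsum f (levels N) + f (Z.of_nat N).
Proof.
  rewrite !lsum_levels. replace (2 * S N)%nat with (S (2 * N + 1)) by lia.
  rewrite <- cons_seq, seq_app, <- seq_shift. cbn [lsum fold_right app].
  fold (lsum (fun m => f (Z.of_nat m - Z.of_nat (S N))%Z) (map S (seq 0 (2 * N)) ++ seq (1 + 2 * N) 1)).
  rewrite lsum_app. cbn [seq lsum fold_right].
  assert (E : lsum (fun m => f (Z.of_nat m - Z.of_nat (S N))%Z) (map S (seq 0 (2 * N)))
    = lsum (fun m => f (Z.of_nat m - Z.of_nat N)%Z) (seq 0 (2 * N))).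
  { unfold lsum. induction (seq 0 (2 * N)) as [|a l IH]; [reflexivity|].
    cbn [map fold_right]. rewrite IH. do 2 f_equal. lia. }
  rewrite E.
  replace (Z.of_nat 0 - Z.of_nat (S N))%Z with (- Z.of_nat (S N))%Z by lia.
  replace (Z.of_nat (1 + 2 * N) - Z.of_nat (S N))%Z with (Z.of_nat N) by lia.
  ring.
Qed.

(** Increasing [N] adds one level at each end. At the bottom no point moves, so the pairs are
    diagonal; at the top the prism over [s] and the prism over the base path coincide and enter with
    opposite signs. *)
Lemma rfill_stable c s : exists l N0, forall N, (N0 <= N)%nat -> rfill N c s = l.
Proof.
  destruct (lift_origin_list (origin :: s)) as [N0 H].
  exists (rfill N0 c s), N0. intros N HN. induction HN as [|N HN IH]; [reflexivity|].
  rewrite <- IH. unfold rfill, fill. rewrite !levels_S.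
  assert (Hlow : forall g : pt -> pt, (forall p, In p s -> In (g p) (origin :: s)) ->
    step (length s) c (map (fun p => pair_lift (1 / 2) (- Z.of_nat (S N)) (g p)) s) = 0).
  { intros g Hg. apply step_diag. intros x Hx. apply in_map_iff in Hx. destruct Hx as [p [<- Hp]].
    destruct (H _ (Hg p Hp) (- Z.of_nat (S N))%Z) as [_ H1]. specialize (H1 ltac:(lia)).
    cbn [pair_lift fst snd]. rewrite !lift_high; [reflexivity|exact H1|].
    rewrite plus_IZR in H1. assert (0 < del) by (unfold del; lra). lra. }
  assert (L1 : step (length s) c (map (pair_lift (1 / 2) (- Z.of_nat (S N))) s) = 0)
    by (apply (Hlow (fun p => p)); now right).
  rewrite L1, (Hlow (fun _ => origin)) by now left.
  rewrite (map_ext_in (pair_lift (1 / 2) (Z.of_nat N)) (fun _ => pair_lift (1 / 2) (Z.of_nat N) origin) s).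
  - ring.
  - intros p Hp. unfold pair_lift.
    destruct (H p (or_intror Hp) (Z.of_nat N)) as [H1 _].
    destruct (H p (or_intror Hp) (Z.of_nat N + 1)%Z) as [H2 _].
    rewrite H1, H2 by lia. reflexivity.
Qed.

Lemma dl_stable {Q : Type} (v : nat -> list Q -> R) (w : list Q -> R) s :
  (forall t, exists N0, forall N, (N0 <= N)%nat -> v N t = w t) ->
  exists N0, forall N, (N0 <= N)%nat -> dl (v N) s = dl w s.
Proof.
  revert v w. induction s as [|x s IH]; intros v w H.
  - exists 0%nat. reflexivity.
  - destruct (H s) as [N1 H1].
    destruct (IH (fun N t => v N (x :: t)) (fun t => w (x :: t)) (fun t => H (x :: t))) as [N2 H2].
    exists (Nat.max N1 N2). intros N HN. cbn [dl]. rewrite H1, H2 by lia. reflexivity.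
Qed.

(** The eventual value of [rfill] is a finite sum, so it stays integral; the number of terms depends
    on the tuple, so no uniform bound comes with it. *)
Lemma primitive m (c : list pt -> R) :
  (forall t, length t = S (S (S m)) -> small rho t -> dl c t = 0) ->
  exists v : list pt -> R,
    (forall s, length s = S (S m) -> small (rho / 2) s -> dl v s = c s) /\
    ((forall t, is_int (c t)) -> forall t, is_int (v t)).
Proof.
  intros Hc.
  set (v := fun s => epsilon (inhabits 0) (fun l => exists N0, forall N, (N0 <= N)%nat -> rfill N c s = l)).
  assert (Hv : forall s, exists N0, forall N, (N0 <= N)%nat -> rfill N c s = v s).
  { intros s. unfold v.
    apply (epsilon_spec (inhabits 0) (fun l => exists N0, forall N, (N0 <= N)%nat -> rfill N c s = l)).
    apply rfill_stable. }
  exists v. split.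
  - intros s Hs Ss. destruct (dl_stable (fun N => rfill N c) v s Hv) as [N1 H1].
    destruct (lift_origin_list s) as [N2 H2].
    rewrite <- (H1 (Nat.max N1 N2)) by lia. apply rfill_dl with m; auto.
    + intros p Hp. destruct (H2 p Hp (- Z.of_nat (Nat.max N1 N2))%Z) as [_ H].
      specialize (H ltac:(lia)). rewrite plus_IZR in H. assert (0 < del) by (unfold del; lra). lra.
    + intros p Hp. apply H2; [exact Hp|lia].
  - intros Hi t. destruct (Hv t) as [N HN]. rewrite <- (HN N (le_n _)).
    unfold rfill, fill.
    assert (Hs : forall g, is_int (lsum (fun M => step (length t) c (map (g M) t)) (levels N))).
    { intros g. apply lsum_int. intros M. now apply step_int. }
    destruct (Hs (pair_lift (1 / 2))) as [x ->].
    destruct (Hs (fun M _ => pair_lift (1 / 2) M origin)) as [y ->].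
    destruct (start_int (length t) c (map diag t) Hi) as [z ->].
    exists (- z - x + y)%Z. now rewrite plus_IZR, minus_IZR, opp_IZR.
Qed.

(** * Averaging over the shifts of the grid *)

Definition disagreement theta M (p q : pt) : R :=
  lsum (fun j => Rabs (IZR (Int_part (fst p j / mesh M + theta))
                       - IZR (Int_part (fst q j / mesh M + theta)))) (seq 0 h).

Lemma disagreement_pos theta M p q : 0 <= disagreement theta M p q.
Proof. apply lsum_pos. intros; apply Rabs_pos. Qed.

(** [disagreement] dominates the indicator of two points not being merged, and unlike that indicator
    it can be summed over the shifts by Hermite's identity. *)
Lemma lift_neq theta M p q : snd p < del * IZR M -> snd q < del * IZR M ->
  lift theta M p <> lift theta M q -> 1 <= disagreement theta M p q.
Proof.
  intros Hp Hq N.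
  destruct (classic (exists j, (j < h)%nat /\
    Int_part (fst p j / mesh M + theta) <> Int_part (fst q j / mesh M + theta))) as [[j [Hj E]]|E].
  - eapply Rle_trans.
    2:{ apply (lsum_ge _ (seq 0 h) j); [intros; apply Rabs_pos|apply in_seq; lia]. }
    cbn. rewrite <- minus_IZR, <- abs_IZR. apply IZR_le. lia.
  - exfalso. apply N, lift_eq; auto. intros m Hm. apply NNPP. intros E'. apply E. now exists m.
Qed.

(** The factor [6] is [rho / 2] divided by [kap]; the exponential is the ratio of the height of [p]
    to that of level [M]. *)
Lemma disagreement_mean n M p q : (0 < n)%nat -> close (rho / 2) p q ->
  lsum (fun i => disagreement (INR i / INR n) M p q) (seq 0 n)
  <= INR h * (INR n * (6 * exp (snd p - del * IZR M)) + 1).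
Proof.
  intros Hn [_ Hx]. unfold disagreement. rewrite lsum_swap.
  rewrite <- (length_seq h 0) at 2. rewrite <- lsum_const.
  apply lsum_le. intros j Hj. apply in_seq in Hj.
  eapply Rle_trans; [apply sum_Int_part_diff; exact Hn|]. apply Rplus_le_compat_r.
  apply Rmult_le_compat_l; [apply pos_INR|].
  pose proof (mesh_pos M) as HM. specialize (Hx j ltac:(lia)).
  replace (fst p j / mesh M - fst q j / mesh M) with ((fst p j - fst q j) / mesh M) by (field; lra).
  unfold Rdiv at 1. rewrite Rabs_mult, Rabs_inv, (Rabs_pos_eq (mesh M)) by lra.
  apply Rmult_le_reg_r with (mesh M); [exact HM|]. rewrite Rmult_assoc, Rinv_l, Rmult_1_r by lra.
  eapply Rle_trans; [exact Hx|]. unfold mesh. unfold Rminus. rewrite exp_plus, exp_Ropp.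
  pose proof (exp_pos (del * IZR M)). right. unfold kap. field. lra.
Qed.

Lemma lift_mean n M p s : (0 < n)%nat -> (forall q, In q s -> close (rho / 2) p q) ->
  lsum (fun i => lsum (disagreement (INR i / INR n) M p) s) (seq 0 n)
  <= INR (length s) * (INR h * (INR n * (6 * exp (snd p - del * IZR M)) + 1)).
Proof.
  intros Hn Hs. rewrite lsum_swap, <- lsum_const. apply lsum_le. intros q Hq.
  now apply disagreement_mean; auto.
Qed.

Lemma all_eq_repeat {A : Type} (a : A) l : (forall x, In x l -> x = a) -> l = repeat a (length l).
Proof.
  intros E. apply Forall_eq_repeat, Forall_forall. intros x Hx. symmetry. auto.
Qed.

(** Either all pairs coincide and the prism is degenerate, or some vertex is separated from [p] at
    one of the levels [M] and [M + 1]. In the latter case the sum of disagreements is at least one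
    and the trivial bound [K * B] suffices. *)
Lemma step_disagreement m : exists K, 0 <= K /\
  forall c B, 0 <= B -> (forall t, length t = S (S (S m)) -> Rabs (c t) <= B) ->
  forall s, length s = S (S m) -> forall theta M,
  Rabs (step (S (S m)) c (map (pair_lift theta M) s)) <= K * B /\
  forall p, snd p < del * IZR M -> (forall q, In q s -> snd q < del * IZR M) ->
  Rabs (step (S (S m)) c (map (pair_lift theta M) s))
  <= K * B * (lsum (disagreement theta M p) s + lsum (disagreement theta (M + 1) p) s).
Proof.
  destruct (step_bound (Q := pt) (S (S m))) as [K [HK H]]. exists K. split; [exact HK|].
  intros c B HB Hc s Hs theta M.
  assert (H1 : Rabs (step (S (S m)) c (map (pair_lift theta M) s)) <= K * B)
    by (apply H; [now rewrite length_map|exact Hc]).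
  split; [exact H1|]. intros p Hp Hl.
  assert (HKB : 0 <= K * B) by now apply Rmult_le_pos.
  assert (P1 : forall M, 0 <= lsum (disagreement theta M p) s)
    by (intros; apply lsum_pos; intros; apply disagreement_pos).
  destruct (classic (exists q, In q s /\ pair_lift theta M q <> pair_lift theta M p)) as [[q [Hq N]]|E].
  - eapply Rle_trans; [exact H1|]. rewrite <- (Rmult_1_r (K * B)) at 1.
    apply Rmult_le_compat_l; [exact HKB|].
    assert (Hd : 0 < del) by (unfold del; lra).
    assert (HM : del * IZR M <= del * IZR (M + 1))
      by (apply Rmult_le_compat_l; [lra|apply IZR_le; lia]).
    specialize (Hl q Hq).
    assert (G : forall M, 1 <= disagreement theta M p q -> 1 <= lsum (disagreement theta M p) s).
    { intros M' G. eapply Rle_trans; [exact G|].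
      apply (lsum_ge (disagreement theta M' p) s q); [intros; apply disagreement_pos|exact Hq]. }
    pose proof (P1 M). pose proof (P1 (M + 1)%Z).
    destruct (classic (lift theta M p = lift theta M q)) as [E1|E1].
    + assert (1 <= lsum (disagreement theta (M + 1) p) s); [|lra].
      apply G, lift_neq; [lra|lra|]. intros E2. apply N. unfold pair_lift. now rewrite E1, E2.
    + assert (1 <= lsum (disagreement theta M p) s); [|lra].
      apply G, lift_neq; [lra|lra|exact E1].
  - replace (map (pair_lift theta M) s) with (repeat (pair_lift theta M p) (S (S m))).
    + rewrite step_repeat, Rabs_R0. apply Rmult_le_pos; [exact HKB|].
      pose proof (P1 M). pose proof (P1 (M + 1)%Z). lra.
    + symmetry. rewrite <- Hs, <- (length_map (pair_lift theta M) s). apply all_eq_repeat.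
      intros x Hx. apply in_map_iff in Hx. destruct Hx as [q [<- Hq]].
      apply NNPP. intros N. apply E. now exists q.
Qed.

Lemma step_mean m : exists K, 0 <= K /\
  forall c B, 0 <= B -> (forall t, length t = S (S (S m)) -> Rabs (c t) <= B) ->
  forall s p, length s = S (S m) -> In p s -> small (rho / 2) s -> forall n M, (0 < n)%nat ->
  lsum (fun i => Rabs (step (S (S m)) c (map (pair_lift (INR i / INR n) M) s))) (seq 0 n)
  <= K * B * (INR n * exp (snd p - del * IZR M) + 1).
Proof.
  destruct (step_disagreement m) as [K [HK H]].
  (* Each of the two levels of a prism contributes a factor [6]; the summand [3] pays for the levels
     that are not above the whole tuple. *)
  set (D := 12 * (INR (S (S m)) * INR h) + 3).
  assert (HD : 0 <= INR (S (S m)) * INR h) by (apply Rmult_le_pos; apply pos_INR).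
  exists (K * D). split; [apply Rmult_le_pos; unfold D; lra|].
  intros c B HB Hc s p Hs Hp Ss n M Hn.
  assert (HKB : 0 <= K * B) by now apply Rmult_le_pos.
  pose proof (exp_pos (snd p - del * IZR M)) as He.
  assert (Hn' : 0 < INR n) by (apply lt_0_INR; lia).
  assert (Hne : 0 <= INR n * exp (snd p - del * IZR M)) by (apply Rmult_le_pos; lra).
  replace (K * D * B * (INR n * exp (snd p - del * IZR M) + 1))
    with (K * B * (D * (INR n * exp (snd p - del * IZR M) + 1))) by ring.
  destruct (Rlt_dec (snd p + rho / 2) (del * IZR M)) as [Hhigh|Hlow].
  - eapply Rle_trans.
    { apply (lsum_le _ (fun i => K * B * lsum (disagreement (INR i / INR n) M p) s
        + K * B * lsum (disagreement (INR i / INR n) (M + 1) p) s)).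
      intros i _. rewrite <- Rmult_plus_distr_l. apply (H c B HB Hc s Hs); [lra|].
      intros q Hq. destruct (Ss p q Hp Hq) as [Hw _]. apply Rabs_le_elim in Hw. lra. }
    rewrite (lsum_lin (K * B) (K * B)), <- Rmult_plus_distr_l.
    apply Rmult_le_compat_l; [exact HKB|].
    assert (E1 := lift_mean n M p s Hn (fun q => Ss p q Hp)).
    assert (E2 := lift_mean n (M + 1) p s Hn (fun q => Ss p q Hp)).
    assert (E3 : exp (snd p - del * IZR (M + 1)) <= exp (snd p - del * IZR M)).
    { left. apply exp_increasing. rewrite plus_IZR. assert (0 < del) by (unfold del; lra). lra. }
    rewrite Hs in E1, E2.
    set (e := exp (snd p - del * IZR M)) in *. set (e' := exp (snd p - del * IZR (M + 1))) in *.
    assert (E4 : INR (S (S m)) * (INR h * (INR n * (6 * e') + 1)) <= INR (S (S m)) * (INR h * (INR n * (6 * e) + 1))).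
    { repeat (apply Rmult_le_compat_l; [apply pos_INR|]). apply Rplus_le_compat_r.
      apply Rmult_le_compat_l; lra. }
    unfold D.
    assert (E5 : INR (S (S m)) * (INR h * (INR n * (6 * e) + 1)) <= (6 * (INR (S (S m)) * INR h)) * (INR n * e + 1)).
    { replace (INR (S (S m)) * (INR h * (INR n * (6 * e) + 1)))
        with (INR (S (S m)) * INR h * (6 * (INR n * e) + 1)) by ring.
      replace (6 * (INR (S (S m)) * INR h) * (INR n * e + 1))
        with (INR (S (S m)) * INR h * (6 * (INR n * e) + 6)) by ring.
      apply Rmult_le_compat_l; lra. }
    lra.
  (* Here [snd p - del * IZR M >= -1], so the exponential is at least [1 / 3] and absorbs the
     trivial bound. *)
  - eapply Rle_trans.
    { apply (lsum_le _ (fun _ => K * B)). intros i _. now apply (H c B HB Hc s Hs). }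
    rewrite lsum_const, length_seq, Rmult_comm. apply Rmult_le_compat_l; [exact HKB|].
    assert (E : 1 <= 3 * exp (snd p - del * IZR M)).
    { assert (1 <= exp 1 * exp (snd p - del * IZR M)).
      { rewrite <- exp_plus. rewrite <- exp_0 at 1.
        destruct (Req_dec 0 (1 + (snd p - del * IZR M))) as [<-|]; [lra|left; apply exp_increasing; lra]. }
      pose proof exp_le_3.
      assert (exp 1 * exp (snd p - del * IZR M) <= 3 * exp (snd p - del * IZR M)) by (apply Rmult_le_compat_r; lra).
      lra. }
    assert (INR n * 1 <= INR n * (3 * exp (snd p - del * IZR M))) by (apply Rmult_le_compat_l; lra).
    assert (3 * (INR n * exp (snd p - del * IZR M) + 1) <= D * (INR n * exp (snd p - del * IZR M) + 1))
      by (apply Rmult_le_compat_r; unfold D; lra).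
    lra.
Qed.

Lemma step_low m c s p theta M : In p s -> small (rho / 2) s ->
  del * IZR (M + 1) <= snd p - rho / 2 -> step m c (map (pair_lift theta M) s) = 0.
Proof.
  intros Hp Ss HM. apply step_diag. intros x Hx. apply in_map_iff in Hx. destruct Hx as [q [<- Hq]].
  destruct (Ss p q Hp Hq) as [Hw _]. apply Rabs_le_elim in Hw.
  cbn [pair_lift fst snd]. rewrite !lift_high; auto; [lra|].
  rewrite plus_IZR in HM. assert (0 < del) by (unfold del; lra). lra.
Qed.

(* The telescoping potential is [A * min (1, exp (w0 - w - del - del M))]: its decrements dominate
   the geometric tail and vanish on the low levels. *)
Lemma geometric_levels w : exists A, 0 <= A /\ forall w0 (f : Z -> R) E N, 0 <= E ->
  (forall M, del * IZR (M + 1) <= w0 - w -> f M = 0) ->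
  (forall M, f M <= exp (w0 - del * IZR M) + E) ->
  lsum f (levels N) <= A + INR (2 * N) * E.
Proof.
  assert (Hd : 0 < del) by (unfold del; lra).
  assert (Hr : exp (- del) < 1) by (rewrite <- exp_0; apply exp_increasing; lra).
  set (A := exp (w + del) / (1 - exp (- del))).
  assert (HA : 0 < A) by (apply Rdiv_lt_0_compat; [apply exp_pos|lra]).
  exists A. split; [lra|]. intros w0 f E N HE Hlow Hf.
  set (v := w0 - w - del).
  set (G := fun M => A * Rmin 1 (exp (v - del * IZR M))).
  assert (HG : forall M, 0 <= G M <= A).
  { intros M. unfold G. pose proof (exp_pos (v - del * IZR M)).
    assert (0 <= Rmin 1 (exp (v - del * IZR M)) <= 1).
    { split; [apply Rmin_glb; lra|apply Rmin_l]. }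
    split; [apply Rmult_le_pos; lra|]. rewrite <- (Rmult_1_r A) at 2. apply Rmult_le_compat_l; lra. }
  eapply Rle_trans.
  { apply (lsum_le _ (fun M => 1 * (G M - G (M + 1)%Z) + 1 * E)). intros M _.
    assert (Hx : del * IZR (M + 1) = del * IZR M + del) by (rewrite plus_IZR; ring).
    destruct (Rle_dec (del * IZR (M + 1)) (w0 - w)) as [HM|HM].
    - rewrite Hlow by exact HM.
      assert (G (M + 1)%Z <= G M); [|lra]. unfold G. apply Rmult_le_compat_l; [lra|].
      apply Rmin_glb; [apply Rmin_l|]. eapply Rle_trans; [apply Rmin_r|].
      left. apply exp_increasing. lra.
    - unfold G. assert (Hv : v - del * IZR M < 0) by (unfold v; lra).
      pose proof (exp_increasing _ _ Hv) as H1. rewrite exp_0 in H1.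
      assert (Hv' : v - del * IZR (M + 1) < 0) by lra.
      pose proof (exp_increasing _ _ Hv') as H2. rewrite exp_0 in H2.
      rewrite !Rmin_right by lra.
      replace (v - del * IZR (M + 1)) with (v - del * IZR M + (- del)) by lra.
      rewrite exp_plus. specialize (Hf M).
      replace (w0 - del * IZR M) with ((w + del) + (v - del * IZR M)) in Hf by (unfold v; ring).
      rewrite exp_plus in Hf.
      replace (1 * (A * exp (v - del * IZR M) - A * (exp (v - del * IZR M) * exp (- del))) + 1 * E)
        with (exp (w + del) * exp (v - del * IZR M) + E); [exact Hf|].
      unfold A. field. lra. }
  rewrite lsum_lin, levels_telescope.
  rewrite (lsum_const E (levels N)). unfold levels. rewrite length_map, length_seq.
  pose proof (HG (- Z.of_nat N)%Z). pose proof (HG (Z.of_nat N)). lra.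
Qed.

(* A short horizontal edge is not collapsed by the grid of level [M] only for a proportion
   [exp (w - del M)] of the shifts, so averaging over the shifts makes the sum over [M] bounded.
   The spacing [1 / (N + 1)] of the shifts keeps the total discretisation error over the [2 N]
   levels bounded as well. *)
Definition mean_fill N (c : list pt -> R) (s : list pt) : R :=
  / INR (S N) * lsum (fun i => fill (INR i / INR (S N)) N c s) (seq 0 (S N)).

Lemma mean_fill_bound m c B : 0 <= B -> (forall t, length t = S (S (S m)) -> Rabs (c t) <= B) ->
  exists C, forall s, length s = S (S m) -> small (rho / 2) s -> forall N, Rabs (mean_fill N c s) <= C.
Proof.
  intros HB Hc. destruct (start_bound (Q := pt) (S (S m))) as [K0 [HK0 H0]].
  destruct (step_mean m) as [K [HK H]]. destruct (geometric_levels (rho / 2)) as [A [HA HG]].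
  assert (HKB : 0 <= K * B) by now apply Rmult_le_pos.
  exists (K0 * B + (K * B + 1) * (A + 2)). intros s Hs Ss N.
  destruct s as [|p s']; [discriminate|]. set (s := p :: s') in *.
  assert (Hp : In p s) by now left.
  set (n := S N). assert (Hn : 0 < INR n) by (apply lt_0_INR; unfold n; lia).
  set (g := fun i M => Rabs (step (S (S m)) c (map (pair_lift (INR i / INR n) M) s))).
  assert (E1 : Rabs (mean_fill N c s) <= / INR n *
     (INR n * (K0 * B) + lsum (fun i => lsum (g i) (levels N)) (seq 0 n))).
  { unfold mean_fill. fold n. rewrite Rabs_mult, (Rabs_pos_eq (/ INR n)) by (left; apply Rinv_0_lt_compat; lra).
    apply Rmult_le_compat_l; [left; apply Rinv_0_lt_compat; lra|].
    eapply Rle_trans; [apply lsum_abs|].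
    rewrite <- (length_seq n 0) at 2. rewrite <- lsum_const.
    rewrite <- (Rmult_1_l (lsum (fun _ => K0 * B) _)), <- (Rmult_1_l (lsum (fun i => lsum (g i) _) _)).
    rewrite <- lsum_lin. apply lsum_le. intros i _. unfold fill. rewrite Hs.
    unfold Rminus. eapply Rle_trans; [apply Rabs_triang|]. rewrite !Rabs_Ropp, !Rmult_1_l.
    apply Rplus_le_compat; [apply H0; [now rewrite length_map|exact Hc]|apply lsum_abs]. }
  rewrite lsum_swap in E1.
  (* Rescaling brings the mean into the form [exp + E] with [E = / INR n]. The divisor is
     [K * B + 1] because [K * B] may be zero. *)
  set (f := fun M => / (K * B + 1) * (/ INR n * lsum (fun i => g i M) (seq 0 n))).
  assert (E2 : lsum f (levels N) <= A + INR (2 * N) * / INR n).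
  { apply (HG (snd p)).
    - left. apply Rinv_0_lt_compat, Hn.
    - intros M HM. unfold f. rewrite (lsum_ext _ (fun _ => 0)); [rewrite lsum_const; ring|].
      intros i _. unfold g. rewrite (step_low _ _ _ p) by assumption. apply Rabs_R0.
    - intros M. unfold f. specialize (H c B HB Hc s p Hs Hp Ss n M ltac:(unfold n; lia)).
      apply Rmult_le_reg_l with (INR n * (K * B + 1)); [apply Rmult_lt_0_compat; lra|].
      replace (INR n * (K * B + 1) * (/ (K * B + 1) * (/ INR n * lsum (fun i => g i M) (seq 0 n))))
        with (lsum (fun i => g i M) (seq 0 n)) by (field; lra).
      replace (INR n * (K * B + 1) * (exp (snd p - del * IZR M) + / INR n))
        with ((K * B + 1) * (INR n * exp (snd p - del * IZR M) + 1)) by (field; lra).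
      eapply Rle_trans; [exact H|]. apply Rmult_le_compat_r; [|lra].
      assert (0 <= INR n * exp (snd p - del * IZR M)) by (apply Rmult_le_pos; [lra|left; apply exp_pos]). lra. }
  rewrite (lsum_ext f (fun M => (/ (K * B + 1) * / INR n) * lsum (fun i => g i M) (seq 0 n) + 0 * 0)) in E2
    by (intros; unfold f; ring).
  rewrite lsum_lin in E2. set (X := lsum (fun M => lsum (fun i => g i M) (seq 0 n)) (levels N)) in *.
  assert (E3 : INR (2 * N) * / INR n <= 2).
  { rewrite mult_INR. change (INR 2) with 2. apply Rmult_le_reg_r with (INR n); [exact Hn|].
    rewrite Rmult_assoc, Rinv_l, Rmult_1_r by lra. unfold n. rewrite S_INR. lra. }
  assert (E4 : / INR n * X <= (K * B + 1) * (A + 2)).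
  { replace (/ INR n * X) with ((K * B + 1) * (/ (K * B + 1) * / INR n * X + 0 * lsum (fun _ => 0) (levels N)))
      by (field; lra).
    apply Rmult_le_compat_l; lra. }
  rewrite Rmult_plus_distr_l, <- Rmult_assoc, Rinv_l, Rmult_1_l in E1 by lra. lra.
Qed.

Lemma phi_disagreement m : exists K, 0 <= K /\
  forall c B, 0 <= B -> (forall t, length t = S (S m) -> Rabs (c t) <= B) ->
  forall s : list pt, length s = S (S m) -> forall theta M (p : pt), snd p < del * IZR M ->
  (forall q, In q s -> snd q < del * IZR M) ->
  Rabs (phi (S (S m)) c (map (lift theta M) s)) <= K * B * lsum (disagreement theta M p) s.
Proof.
  destruct (phi_bound (Q := pt) (S (S m))) as [K [HK H]]. exists K. split; [exact HK|].
  intros c B HB Hc s Hs theta M p Hp Hl.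
  assert (HKB : 0 <= K * B) by now apply Rmult_le_pos.
  destruct (classic (exists q, In q s /\ lift theta M q <> lift theta M p)) as [[q [Hq N]]|E].
  - apply Rle_trans with (K * B * 1).
    + rewrite Rmult_1_r. apply H; [now rewrite length_map|auto].
    + apply Rmult_le_compat_l; [exact HKB|]. apply Rle_trans with (disagreement theta M p q).
      * apply lift_neq; auto.
      * apply (lsum_ge (disagreement theta M p)); [intros; apply disagreement_pos|exact Hq].
  - pose proof (all_eq_repeat (lift theta M p) (map (lift theta M) s)) as Er.
    rewrite length_map, Hs in Er. rewrite Er.
    + rewrite phi_repeat, Rabs_R0. apply Rmult_le_pos; [exact HKB|].
      apply lsum_pos. intros; apply disagreement_pos.
    + intros x Hx. apply in_map_iff in Hx. destruct Hx as [q [<- Hq]].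
      apply NNPP. intros N. apply E. now exists q.
Qed.

(** The defect is the mean of the [phi] term at level [N]. For fixed [s] it is of order
    [exp (- del N) + 1 / N], hence tends to zero; [D] and [N0] may depend on [s] because only a
    pointwise limit is taken. *)
Lemma mean_fill_dl m c B s : 0 <= B ->
  (forall t, length t = S (S (S m)) -> Rabs (c t) <= B) ->
  (forall t, length t = S (S (S (S m))) -> small rho t -> dl c t = 0) ->
  length s = S (S (S m)) -> small (rho / 2) s ->
  exists D N0, forall N, (N0 <= N)%nat -> INR N * Rabs (dl (mean_fill N c) s - c s) <= D.
Proof.
  intros HB Hc Hd Hs Ss.
  destruct s as [|p s']; [discriminate|]. set (s := p :: s') in *.
  assert (Hp : In p s) by now left.
  destruct (phi_disagreement (S m)) as [K [HK H]].
  assert (HKB : 0 <= K * B) by now apply Rmult_le_pos.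
  assert (Hdel : 0 < del) by (unfold del; lra).
  destruct (INR_unbounded ((Rabs (snd p) + rho) / del)) as [N0 HN0].
  set (L := INR (length s) * INR h).
  assert (HL : 0 <= L) by (apply Rmult_le_pos; apply pos_INR).
  exists (K * B * (L * (6 * exp (snd p) / del + 1))), N0. intros N HN.
  assert (HNd : Rabs (snd p) + rho < del * INR N).
  { apply le_INR in HN. replace (Rabs (snd p) + rho) with (del * ((Rabs (snd p) + rho) / del)) by (field; lra).
    apply Rmult_lt_compat_l; lra. }
  pose proof (Rle_abs (snd p)) as Ha. pose proof (Rle_abs (- snd p)) as Ha'. rewrite Rabs_Ropp in Ha'.
  assert (Hh : forall q, In q s -> snd p - rho <= snd q <= snd p + rho).
  { intros q Hq. destruct (Ss p q Hp Hq) as [Hw _]. apply Rabs_le_elim in Hw. lra. }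
  assert (HZ : IZR (Z.of_nat N) = INR N) by (symmetry; apply INR_IZR_INZ).
  set (n := S N). assert (Hn : 0 < INR n) by (apply lt_0_INR; unfold n; lia).
  assert (E : dl (mean_fill N c) s - c s =
    / INR n * lsum (fun i => (-1) * phi (S (S (S m))) c (map (lift (INR i / INR n) (Z.of_nat N)) s)) (seq 0 n)).
  { unfold mean_fill. fold n.
    rewrite (dl_ext s _ (fun t => / INR n * lsum (fun i => fill (INR i / INR n) N c t) (seq 0 n) + 0 * 0))
      by (intros; ring).
    rewrite (dl_lin s _ _ _ (fun _ => 0)), (dl_lsum (fun i t => fill (INR i / INR n) N c t)).
    rewrite (lsum_ext _ (fun i => 1 * c s + 1 * ((-1) * phi (S (S (S m))) c (map (lift (INR i / INR n) (Z.of_nat N)) s)))).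
    - rewrite (lsum_lin 1 1), lsum_const, length_seq. field. lra.
    - intros i _. rewrite (fill_dl _ _ _ _ (S (S m))); auto; [ring|].
      intros q Hq. rewrite opp_IZR, HZ. specialize (Hh q Hq). lra. }
  rewrite E, Rabs_mult, (Rabs_pos_eq (/ INR n)) by (left; apply Rinv_0_lt_compat; lra).
  assert (E1 : Rabs (lsum (fun i => (-1) * phi (S (S (S m))) c (map (lift (INR i / INR n) (Z.of_nat N)) s)) (seq 0 n))
    <= K * B * (L * (INR n * (6 * exp (snd p - del * INR N)) + 1))).
  { eapply Rle_trans; [apply lsum_abs|].
    eapply Rle_trans.
    { apply (lsum_le _ (fun i => K * B * lsum (disagreement (INR i / INR n) (Z.of_nat N) p) s + 0 * 0)).
      intros i _. rewrite Rabs_mult, (Rabs_left1 (-1)) by lra. replace (- (-1)) with 1 by ring. rewrite Rmult_1_l.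
      rewrite Rmult_0_l, Rplus_0_r. apply H; auto.
      - rewrite HZ. lra.
      - intros q Hq. rewrite HZ. specialize (Hh q Hq). lra. }
    rewrite (lsum_lin _ _ (fun i => lsum (disagreement (INR i / INR n) (Z.of_nat N) p) s)), Rmult_0_l, Rplus_0_r.
    apply Rmult_le_compat_l; [exact HKB|]. rewrite <- HZ. unfold L. rewrite Rmult_assoc.
    apply lift_mean; [unfold n; lia|intros; now apply Ss]. }
  assert (HN' : 0 < INR N).
  { destruct (Rle_lt_or_eq_dec 0 (INR N) (pos_INR N)) as [|Z0]; [assumption|].
    rewrite <- Z0 in HNd. pose proof (Rabs_pos (snd p)). lra. }
  assert (E2 : INR N * exp (snd p - del * INR N) <= exp (snd p) / del).
  { unfold Rminus. rewrite exp_plus, exp_Ropp. pose proof (exp_pos (snd p)).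
    assert (del * INR N <= exp (del * INR N)).
    { pose proof (exp_ineq1 (del * INR N)). assert (0 < del * INR N) by (apply Rmult_lt_0_compat; lra). lra. }
    pose proof (exp_pos (del * INR N)).
    apply Rmult_le_reg_r with (del * exp (del * INR N)); [apply Rmult_lt_0_compat; lra|].
    replace (INR N * (exp (snd p) * / exp (del * INR N)) * (del * exp (del * INR N)))
      with (exp (snd p) * (del * INR N)) by (field; lra).
    replace (exp (snd p) / del * (del * exp (del * INR N))) with (exp (snd p) * exp (del * INR N)) by (field; lra).
    apply Rmult_le_compat_l; lra. }
  apply Rle_trans with (INR N * (/ INR n * (K * B * (L * (INR n * (6 * exp (snd p - del * INR N)) + 1))))).
  { apply Rmult_le_compat_l; [lra|]. apply Rmult_le_compat_l; [left; apply Rinv_0_lt_compat; lra|exact E1]. }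
  replace (INR N * (/ INR n * (K * B * (L * (INR n * (6 * exp (snd p - del * INR N)) + 1)))))
    with (K * B * (L * (6 * (INR N * exp (snd p - del * INR N)) + INR N * / INR n))) by (field; lra).
  apply Rmult_le_compat_l; [exact HKB|]. apply Rmult_le_compat_l; [exact HL|].
  assert (INR N * / INR n <= 1).
  { apply Rmult_le_reg_r with (INR n); [exact Hn|]. rewrite Rmult_assoc, Rinv_l by lra.
    unfold n. rewrite S_INR. lra. }
  unfold Rdiv in *. lra.
Qed.

(** The limit of the averages along a free ultrafilter exists by boundedness alone, inherits the
    bound, and commutes with the finite sum [dl]. *)
Lemma bounded_primitive m c B :
  (forall t, length t = S (S (S m)) -> Rabs (c t) <= B) ->
  (forall t, length t = S (S (S (S m))) -> small rho t -> dl c t = 0) ->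
  exists (b : list pt -> R) C,
    (forall s, length s = S (S m) -> small (rho / 2) s -> Rabs (b s) <= C) /\
    (forall s, length s = S (S (S m)) -> small (rho / 2) s -> dl b s = c s).
Proof.
  intros Hc Hd. destruct ultra_nat as [U [HU Hcof]].
  assert (HB : 0 <= B).
  { apply Rle_trans with (Rabs (c (repeat origin (S (S (S m)))))); [apply Rabs_pos|].
    apply Hc, repeat_length. }
  destruct (mean_fill_bound m c B HB Hc) as [C HC].
  set (b := fun s => epsilon (inhabits 0) (fun l => ulim U (fun N => mean_fill N c s) l)).
  assert (Hb : forall s, length s = S (S m) -> small (rho / 2) s ->
    ulim U (fun N => mean_fill N c s) (b s)).
  { intros s Hs Ss. unfold b.
    apply (epsilon_spec (inhabits 0) (fun l => ulim U (fun N => mean_fill N c s) l)).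
    apply (ulim_exists U HU _ C). intros N. now apply HC. }
  exists b, C. split.
  - intros s Hs Ss. apply (ulim_bound U HU (fun N => mean_fill N c s)); auto.
  - intros s Hs Ss. apply (ulim_unique U HU (fun N => dl (mean_fill N c) s)).
    + apply (ulim_dl U HU (fun N => mean_fill N c)). intros r Hr Ir. apply Hb; [lia|].
      now apply small_incl with s.
    + intros eps He. destruct (mean_fill_dl m c B s HB Hc Hd Hs Ss) as [D [N0 HD]].
      destruct (INR_unbounded (Rabs D / eps)) as [N1 HN1].
      apply (ultra_S U HU (fun N => (Nat.max N0 N1 <= N)%nat)); [|apply Hcof].
      intros N HN. specialize (HD N ltac:(lia)).
      assert (HN' : INR N1 <= INR N) by (apply le_INR; lia).
      pose proof (Rabs_pos D). pose proof (Rle_abs D).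
      assert (0 <= Rabs D / eps) by (apply Rmult_le_pos; [lra|left; apply Rinv_0_lt_compat; lra]).
      apply Rnot_le_lt. intros Hge.
      assert (INR N * eps <= D).
      { eapply Rle_trans; [|exact HD]. apply Rmult_le_compat_l; lra. }
      assert (Rabs D < INR N * eps); [|lra].
      replace (Rabs D) with (Rabs D / eps * eps) by (field; lra). apply Rmult_lt_compat_r; lra.
Qed.

End Model.

Lemma bounded_integral_primitive h rho m (c : list pt -> R) B : 0 < rho -> rho <= 1 ->
  (forall t, is_int (c t)) ->
  (forall t, length t = S (S (S m)) -> Rabs (c t) <= B) ->
  (forall t, length t = S (S (S (S m))) -> small h rho t -> dl c t = 0) ->
  exists (b : list pt -> Z) C,
    (forall s, length s = S (S m) -> small h (rho / 4) s -> Rabs (IZR (b s)) <= C) /\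
    (forall s, length s = S (S (S m)) -> small h (rho / 4) s -> dl (fun t => IZR (b t)) s = c s).
Proof.
  intros H0 H1 Hi Hc Hd.
  destruct (bounded_primitive h rho H0 H1 m c B Hc Hd) as [br [C [HbC Hbd]]].
  destruct (primitive h rho H0 H1 (S m) c Hd) as [bi [Hid Hii]]. specialize (Hii Hi).
  (* [bi - br] is known to be a cocycle only on tuples of radius [rho / 2], so its primitive costs a
     second halving; hence [rho / 4]. *)
  destruct (primitive h (rho / 2) ltac:(lra) ltac:(lra) m (fun t => bi t - br t)) as [g [Hg _]].
  { intros t Ht St. rewrite dl_minus, Hid, Hbd by assumption. ring. }
  replace (rho / 2 / 2) with (rho / 4) in Hg by field.
  (* [bi - dl fl] is integral, and it equals [br + dl (g - fl)], which is bounded. *)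
  set (fl := fun t => IZR (Int_part (g t))).
  assert (Hb : forall s, is_int (bi s - dl fl s)).
  { intros s. apply is_int_minus; [apply Hii|]. apply dl_int. intros t. now eexists. }
  set (b := fun s => epsilon (inhabits 0%Z) (fun z => bi s - dl fl s = IZR z)).
  assert (Eb : forall s, IZR (b s) = bi s - dl fl s).
  { intros s. symmetry. apply (epsilon_spec (inhabits 0%Z) (fun z => bi s - dl fl s = IZR z)), Hb. }
  exists b, (C + INR (S (S m))). split.
  - intros s Hs Ss. rewrite Eb.
    replace (bi s - dl fl s) with (br s + dl (fun t => g t - fl t) s).
    + eapply Rle_trans; [apply Rabs_triang|]. apply Rplus_le_compat.
      * apply HbC; [exact Hs|]. apply small_mono with (rho / 4); [lra|exact Ss].
      * rewrite <- (Rmult_1_r (INR (S (S m)))), <- Hs. apply dl_bound. intros t _ _. unfold fl.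
        destruct (base_Int_part (g t)). apply Rabs_le. lra.
    + rewrite dl_minus, Hg by assumption. ring.
  - intros s Hs Ss. rewrite (dl_ext s _ (fun t => bi t - dl fl t)) by (intros; apply Eb).
    rewrite dl_minus, dl_dl, Hid; [ring|exact Hs|]. apply small_mono with (rho / 4); [lra|exact Ss].
Qed.

(** * The Higson compactification *)

Lemma common_radius {A : Type} (P : A -> R -> Prop) (l : list A) :
  (forall a r r', 0 < r' <= r -> P a r -> P a r') ->
  (forall a, In a l -> exists r, 0 < r /\ P a r) ->
  exists r, 0 < r /\ forall a, In a l -> P a r.
Proof.
  intros Hm. induction l as [|a l IH]; intros H.
  - exists 1. split; [lra|intros a []].
  - destruct IH as [r [Hr IH]]; [intros; apply H; now right|].
    destruct (H a (or_introl eq_refl)) as [r' [Hr' H']].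
    assert (0 < Rmin r r') by now apply Rmin_glb_lt.
    exists (Rmin r r'). split; [assumption|]. intros b [<-|Hb].
    + apply Hm with r'; [split; [assumption|apply Rmin_r]|exact H'].
    + apply Hm with r; [split; [assumption|apply Rmin_l]|auto].
Qed.

Section Compactification.
Context {X : Type} (d : X -> X -> R).

Lemma h0_eval_proof (x : X) : forall (l : list (HigsonFun X d)) (eps : R), 0 < eps ->
  exists y : X, forall f, In f l -> Rabs (proj1_sig f x - proj1_sig f y) < eps.
Proof. intros l eps He. exists x. intros f _. rewrite Rminus_diag, Rabs_R0. exact He. Qed.

Definition h0_eval (x : X) : h0pt X d := exist _ (fun f => proj1_sig f x) (h0_eval_proof x).

Lemma ultra_list {T A : Type} (U : (T -> Prop) -> Prop) (P : A -> T -> Prop) l : ultra U ->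
  (forall a, In a l -> U (P a)) -> U (fun x => forall a, In a l -> P a x).
Proof.
  intros HU. induction l as [|a l IH]; intros H.
  - apply (ultra_S U HU (fun _ => True)); [intros x _ a []|apply ultra_T, HU].
  - apply (ultra_S U HU (fun x => P a x /\ forall b, In b l -> P b x)).
    + intros x [H1 H2] b [<-|Hb]; auto.
    + apply ultra_I; [exact HU|apply H; now left|apply IH; intros; apply H; now right].
Qed.

(** A Lebesgue number for the cover, uniform over the points of [X]. If no choice of [l], [eps], [J]
    worked, the sets of bad points would form a filter base. Limits of all Higson functions along an
    ultrafilter refining it define a point of [h0pt], and a basic neighbourhood of that point inside
    some [U i] contradicts badness for [[i]]. *)
Lemma h0_lebesgue {I : Type} (U : I -> h0pt X d -> Prop) : open_cover (h0open X d) U ->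
  exists (l : list (HigsonFun X d)) (eps : R) (J : list I), 0 < eps /\
  forall x, exists i, In i J /\
    forall p : h0pt X d, (forall f, In f l -> Rabs (proj1_sig p f - proj1_sig f x) < eps) -> U i p.
Proof.
  intros [Uo Uc]. apply NNPP. intros Hno.
  set (bad := fun (l : list (HigsonFun X d)) (eps : R) (J : list I) (x : X) =>
    forall i, In i J -> ~ forall p : h0pt X d,
      (forall f, In f l -> Rabs (proj1_sig p f - proj1_sig f x) < eps) -> U i p).
  assert (bad_mono : forall l l' eps eps' J J' x, incl l l' -> eps' <= eps -> incl J J' ->
    bad l' eps' J' x -> bad l eps J x).
  { intros l l' eps eps' J J' x Il He IJ Hb i Hi HU. apply (Hb i (IJ i Hi)).
    intros p Hp. apply HU. intros f Hf. specialize (Hp f (Il f Hf)). lra. }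
  destruct (ultra_extend (fun A => exists l eps J, 0 < eps /\ A = bad l eps J)) as [G [HG Gbase]].
  - exists (bad [] 1 []), [], 1, []. split; [lra|reflexivity].
  - intros A B [l [e [J [He ->]]]] [l' [e' [J' [He' ->]]]].
    exists (bad (l ++ l') (Rmin e e') (J ++ J')). split.
    + exists (l ++ l'), (Rmin e e'), (J ++ J'). split; [now apply Rmin_glb_lt|reflexivity].
    + intros x Hx. split; (eapply bad_mono; [| | |exact Hx]).
      all: try apply Rmin_l; try apply Rmin_r.
      all: try (apply incl_appl, incl_refl); apply incl_appr, incl_refl.
  - intros A [l [e [J [He ->]]]]. apply NNPP. intros N. apply Hno. exists l, e, J.
    split; [exact He|]. intros x. apply NNPP. intros N'. apply N. exists x.
    intros i Hi HU. apply N'. now exists i.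
  - set (phi := fun f : HigsonFun X d => epsilon (inhabits 0) (fun r => ulim G (proj1_sig f) r)).
    assert (Hphi : forall f, ulim G (proj1_sig f) (phi f)).
    { intros f. unfold phi. apply (epsilon_spec (inhabits 0) (fun r => ulim G (proj1_sig f) r)).
      destruct f as [f [[M HM] Hf]]. now apply (ulim_exists G HG f M). }
    assert (Hnear : forall (l : list (HigsonFun X d)) eps, 0 < eps ->
      G (fun x => forall f, In f l -> Rabs (proj1_sig f x - phi f) < eps)).
    { intros l eps He. apply (ultra_list G (fun f x => Rabs (proj1_sig f x - phi f) < eps)); [exact HG|].
      intros f _. now apply Hphi. }
    assert (Hpt : forall (l : list (HigsonFun X d)) (eps : R), 0 < eps ->
      exists x : X, forall f, In f l -> Rabs (phi f - proj1_sig f x) < eps).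
    { intros l eps He. destruct (ultra_ex G HG _ (Hnear l eps He)) as [x Hx].
      exists x. intros f Hf. rewrite Rabs_minus_sym. auto. }
    set (q := exist _ phi Hpt : h0pt X d).
    destruct (Uc q) as [i Hi]. destruct (Uo i q Hi) as [l [eps [He Hq]]].
    assert (Hb : G (bad l (eps / 2) [i])).
    { apply Gbase. exists l, (eps / 2), [i]. split; [lra|reflexivity]. }
    destruct (ultra_ex G HG _ (ultra_I G HG _ _ Hb (Hnear l (eps / 2) ltac:(lra)))) as [x [Hx Hx']].
    apply (Hx i); [now left|]. intros p Hp. apply Hq. intros f Hf. cbn.
    specialize (Hp f Hf). specialize (Hx' f Hf). apply Rabs_def2 in Hp, Hx'. apply Rabs_def1; lra.
Qed.

Hypothesis d_refl : forall x, d x x = 0.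
(** The triangle inequality up to uniform equivalence. Uniform continuity sees no more than this,
    and for [hdist] it follows from the comparison with [close], without hyperbolic trigonometry. *)
Hypothesis d_triangle : forall r, 0 < r -> exists s, 0 < s /\
  forall x y z, d x y < s -> d y z < s -> d x z < r.

Definition unif_continuous (f : X -> R) : Prop := forall eps, 0 < eps ->
  exists delta, 0 < delta /\ forall x y, d x y < delta -> Rabs (f x - f y) < eps.

Lemma mcompact_list (l : list X) : mcompact d (fun x => In x l).
Proof.
  intros I U _ Hc. induction l as [|a l IH].
  - exists []. intros x [].
  - destruct IH as [L HL]; [intros; apply Hc; now right|].
    destruct (Hc a (or_introl eq_refl)) as [i Hi]. exists (i :: L).
    intros x [<-|Hx]; [exists i; split; [now left|exact Hi]|].
    destruct (HL x Hx) as [j [Hj Uj]]. exists j. split; [now right|exact Uj].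
Qed.

Lemma min_pos_list {A : Type} (f : A -> R) l : (forall a, In a l -> 0 < f a) ->
  exists m, 0 < m /\ forall a, In a l -> m <= f a.
Proof.
  intros Hf. apply (common_radius (fun a r => r <= f a)).
  - intros; lra.
  - intros a Ha. exists (f a). split; [auto|lra].
Qed.

Lemma compact_uniform f K eps : mcontinuous d f -> mcompact d K -> 0 < eps ->
  exists delta, 0 < delta /\ forall x y, K x -> d x y < delta -> Rabs (f x - f y) < eps.
Proof.
  intros Hf HK He.
  assert (Hs : forall z, exists s, 0 < s /\ (forall x, d z x < s -> Rabs (f z - f x) < eps / 2) /\
     (forall x y, d z x < s -> d x y < s -> Rabs (f z - f y) < eps / 2)).
  { intros z. destruct (Hf z (eps / 2) ltac:(lra)) as [r [Hr Hz]].
    destruct (d_triangle r Hr) as [s [Hs Ht]]. exists (Rmin r s).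
    split; [now apply Rmin_glb_lt|]. pose proof (Rmin_l r s). pose proof (Rmin_r r s). split.
    - intros x Hx. apply Hz. lra.
    - intros x y Hx Hy. apply Hz, (Ht z x y); lra. }
  set (sz := fun z => epsilon (inhabits 0) (fun s => 0 < s /\ (forall x, d z x < s -> Rabs (f z - f x) < eps / 2) /\
     (forall x y, d z x < s -> d x y < s -> Rabs (f z - f y) < eps / 2))).
  assert (Hsz : forall z, 0 < sz z /\ (forall x, d z x < sz z -> Rabs (f z - f x) < eps / 2) /\
     (forall x y, d z x < sz z -> d x y < sz z -> Rabs (f z - f y) < eps / 2)).
  { intros z. unfold sz. apply epsilon_spec, Hs. }
  (* Under the weak triangle inequality balls need not be open, so the cover consists of their
     interiors. *)
  destruct (HK X (fun z x => exists r, 0 < r /\ forall y, d x y < r -> d z y < sz z)) as [l Hl].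
  - intros z x [r [Hr Hx]]. destruct (d_triangle r Hr) as [s [Hs' Ht]]. exists s. split; [exact Hs'|].
    intros y Hy. exists s. split; [exact Hs'|]. intros w Hw. apply Hx. now apply (Ht x y w).
  - intros x _. exists x, (sz x). split; [apply Hsz|auto].
  - destruct (min_pos_list sz l (fun z _ => proj1 (Hsz z))) as [m [Hm Hml]].
    exists m. split; [exact Hm|]. intros x y Hx Hxy.
    destruct (Hl x Hx) as [z [Hz [r [Hr Hzr]]]].
    assert (Hzx : d z x < sz z) by (apply Hzr; now rewrite d_refl).
    destruct (Hsz z) as [_ [H1 H2]]. specialize (H1 x Hzx). specialize (Hml z Hz).
    specialize (H2 x y Hzx ltac:(lra)). apply Rabs_def2 in H1, H2. apply Rabs_def1; lra.
Qed.

Lemma inv_S_small eps : 0 < eps -> exists n0, forall n, (n0 <= n)%nat -> / INR (S n) < eps.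
Proof.
  intros He. destruct (INR_unbounded (/ eps)) as [n0 H]. exists n0. intros n Hn.
  rewrite <- (Rinv_inv eps). apply Rinv_lt_contravar.
  - apply Rmult_lt_0_compat; [now apply Rinv_0_lt_compat|apply lt_0_INR; lia].
  - apply Rlt_le_trans with (INR n0); [exact H|apply le_INR; lia].
Qed.

(* A sequence of pairs violating uniform continuity is a [C_0]-controlled set. *)
Lemma higson_unif_continuous f : is_higson_fun d f -> unif_continuous f.
Proof.
  intros [_ [Hc Hh]] eps He. apply NNPP. intros Hno.
  assert (Hn : forall n, exists xy : X * X,
    d (fst xy) (snd xy) < / INR (S n) /\ eps <= Rabs (f (fst xy) - f (snd xy))).
  { intros n. apply NNPP. intros N. apply Hno. exists (/ INR (S n)).
    split; [apply Rinv_0_lt_compat, lt_0_INR; lia|]. intros x y Hxy. apply Rnot_le_lt. intros H.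
    apply N. now exists (x, y). }
  destruct (Hn 0%nat) as [xy0 _].
  set (xy := fun n => epsilon (inhabits xy0) (fun xy => d (fst xy) (snd xy) < / INR (S n) /\
     eps <= Rabs (f (fst xy) - f (snd xy)))).
  assert (Hxy : forall n, d (fst (xy n)) (snd (xy n)) < / INR (S n) /\
     eps <= Rabs (f (fst (xy n)) - f (snd (xy n)))).
  { intros n. unfold xy. apply epsilon_spec, Hn. }
  set (E := fun x y => exists n, x = fst (xy n) /\ y = snd (xy n)).
  assert (HE : c0_controlled d E).
  { intros e Hpos. destruct (inv_S_small e Hpos) as [n0 Hn0].
    exists (fun x => In x (map (fun n => fst (xy n)) (seq 0 n0) ++ map (fun n => snd (xy n)) (seq 0 n0))).
    split; [apply mcompact_list|]. intros x y [n [-> ->]] HK.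
    destruct (Nat.le_gt_cases n0 n) as [Hle|Hlt].
    - specialize (Hn0 n Hle). pose proof (proj1 (Hxy n)). lra.
    - exfalso. apply HK. split; apply in_or_app; [left|right];
        (apply in_map_iff; exists n; split; [reflexivity|apply in_seq; lia]). }
  destruct (Hh E HE eps He) as [K [HK HKE]].
  destruct (compact_uniform f K eps Hc HK He) as [r [Hr HKr]].
  destruct (inv_S_small r Hr) as [n0 Hn0]. specialize (Hn0 n0 (le_n _)).
  destruct (Hxy n0) as [H1 H2].
  destruct (classic (K (fst (xy n0)) /\ K (snd (xy n0)))) as [[HKx _]|HnK].
  - specialize (HKr _ (snd (xy n0)) HKx ltac:(lra)). lra.
  - specialize (HKE _ _ (ex_intro _ n0 (conj eq_refl eq_refl)) HnK). lra.
Qed.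

Lemma unif_continuous_higson f : fbounded f -> unif_continuous f -> is_higson_fun d f.
Proof.
  intros Hb Hu. split; [exact Hb|]. split.
  - intros x eps He. destruct (Hu eps He) as [r [Hr H]]. exists r. split; auto.
  - intros E HE eps He. destruct (Hu eps He) as [r [Hr H]].
    destruct (HE r Hr) as [K [HK HKE]]. exists K. split; auto.
Qed.

End Compactification.

(** * Hyperbolic space *)

Lemma arcosh_lower s r : 0 <= s -> arcosh (1 + s) < r -> s < exp r - 1.
Proof.
  intros Hs H. unfold arcosh in H. apply exp_increasing in H.
  pose proof (sqrt_pos ((1 + s) * (1 + s) - 1)). rewrite exp_ln in H by lra. lra.
Qed.

Lemma arcosh_upper r : 0 < r -> exists sg, 0 < sg /\ forall s, 0 <= s < sg -> arcosh (1 + s) < r.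
Proof.
  intros Hr. set (e := exp r - 1).
  assert (He : 0 < e) by (pose proof (exp_ineq1 r); unfold e; lra).
  assert (He2 : 0 < e * e) by now apply Rmult_lt_0_compat.
  (* For [s <= 1] the radicand is at most [3 * s], so [s < e * e / 12] makes the root smaller than
     [e / 2]; the other half of [e] is for [s] itself. *)
  exists (Rmin (e / 2) (Rmin 1 (e * e / 12))). split.
  { repeat apply Rmin_glb_lt; lra. }
  intros s [H0 H].
  pose proof (Rlt_le_trans _ _ _ H (Rmin_l _ _)) as H1.
  pose proof (Rlt_le_trans _ _ _ H (Rmin_r _ _)) as H2.
  pose proof (Rlt_le_trans _ _ _ H2 (Rmin_l _ _)) as H3.
  pose proof (Rlt_le_trans _ _ _ H2 (Rmin_r _ _)) as H4.
  assert (Hsq : sqrt ((1 + s) * (1 + s) - 1) < e / 2).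
  { rewrite <- (sqrt_square (e / 2)) by lra. apply sqrt_lt_1; nra. }
  pose proof (sqrt_pos ((1 + s) * (1 + s) - 1)).
  unfold arcosh. rewrite <- (ln_exp r). apply ln_increasing; unfold e in *; lra.
Qed.

Lemma sqdist_lsum n x y : sqdist n x y = lsum (fun i => (x i - y i) * (x i - y i)) (seq 0 n).
Proof. unfold sqdist, lsum. induction (seq 0 n); cbn; [reflexivity|now rewrite IHl]. Qed.

Section Hyperbolic.
Variable h : nat.
Let n := S h.

Definition coords (y : Hpt n) : pt := (proj1_sig y, ln (proj1_sig y h)).

Lemma exp_coords y : exp (snd (coords y)) = proj1_sig y h.
Proof. unfold coords. cbn. apply exp_ln. exact (proj2 (proj2_sig y)). Qed.

Lemma exp_close_3 a b r : r <= 1 -> Rabs (a - b) <= r -> exp b <= 3 * exp a.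
Proof.
  intros Hr H. apply Rabs_le_elim in H. apply Rle_trans with (exp (1 + a)).
  - destruct (Req_dec b (1 + a)) as [->|]; [lra|left; apply exp_increasing; lra].
  - rewrite exp_plus. apply Rmult_le_compat_r; [left; apply exp_pos|apply exp_le_3].
Qed.

(** The hyperbolic cosine of the distance, minus one. *)
Definition chord (p q : Hpt n) : R :=
  sqdist n (proj1_sig p) (proj1_sig q) / (2 * proj1_sig p h * proj1_sig q h).

Lemma hdist_chord p q : hdist n p q = arcosh (1 + chord p q).
Proof. reflexivity. Qed.

Lemma height_pos (p : Hpt n) : 0 < proj1_sig p h.
Proof. exact (proj2 (proj2_sig p)). Qed.

Lemma sqdist_pos x y : 0 <= sqdist n x y.
Proof. rewrite sqdist_lsum. apply lsum_pos. intros; apply Rle_0_sqr. Qed.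

Lemma chord_pos p q : 0 <= chord p q.
Proof.
  pose proof (height_pos p). pose proof (height_pos q). pose proof (sqdist_pos (proj1_sig p) (proj1_sig q)).
  unfold chord. apply Rmult_le_pos; [assumption|]. left. apply Rinv_0_lt_compat.
  apply Rmult_lt_0_compat; lra.
Qed.

(** If [b - a > eta], then [t = exp b] exceeds [(1 + eta) * s] for [s = exp a]. This gives
    [s * eta <= t - s] and [t * eta <= (t - s) * (1 + eta)], whose product contradicts the
    hypothesis. *)
Lemma log_gap a b eta : 0 < eta -> (exp b - exp a) * (exp b - exp a) * (1 + eta) < eta * eta * (exp a * exp b) ->
  b - a <= eta.
Proof.
  intros He H. apply Rnot_lt_le. intros Hlt.
  assert (Hab : exp a * (1 + eta) < exp b).
  { apply Rle_lt_trans with (exp (a + eta)).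
    - rewrite exp_plus. apply Rmult_le_compat_l; [left; apply exp_pos|left; now apply exp_ineq1; lra].
    - apply exp_increasing. lra. }
  pose proof (exp_pos a) as Ha. pose proof (exp_pos b) as Hb.
  set (s := exp a) in *. set (t := exp b) in *.
  assert (H1 : s * eta <= t - s) by lra.
  assert (H2 : t * eta <= (t - s) * (1 + eta)) by lra.
  assert ((s * eta) * (t * eta) <= (t - s) * ((t - s) * (1 + eta))).
  { apply Rmult_le_compat; try assumption; apply Rmult_le_pos; lra. }
  lra.
Qed.

Lemma chord_close eta : 0 < eta -> eta <= 1 -> forall p q,
  chord p q < eta * eta / 8 -> close h eta (coords p) (coords q).
Proof.
  intros H0 H1 p q H.
  pose proof (height_pos p) as Hp. pose proof (height_pos q) as Hq.
  pose proof (exp_coords p) as Ep. pose proof (exp_coords q) as Eq.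
  set (x := proj1_sig p) in *. set (y := proj1_sig q) in *.
  assert (Hpq : 0 < x h * y h) by now apply Rmult_lt_0_compat.
  assert (Hs : sqdist n x y < eta * eta / 4 * (x h * y h)).
  { unfold chord in H. fold x y in H.
    apply Rmult_lt_reg_r with (/ (2 * (x h * y h))); [apply Rinv_0_lt_compat; lra|].
    replace (eta * eta / 4 * (x h * y h) * / (2 * (x h * y h))) with (eta * eta / 8) by (field; lra).
    replace (2 * (x h * y h)) with (2 * x h * y h) by ring. exact H. }
  assert (Hi : forall i, (i < n)%nat -> (x i - y i) * (x i - y i) < eta * eta / 4 * (x h * y h)).
  { intros i Hi. eapply Rle_lt_trans; [|exact Hs]. rewrite sqdist_lsum.
    apply (lsum_ge (fun i => (x i - y i) * (x i - y i)) (seq 0 n) i).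
    - intros; apply Rle_0_sqr.
    - apply in_seq. lia. }
  assert (Hh := Hi h ltac:(unfold n; lia)).
  assert (He2 : 0 < eta * eta) by now apply Rmult_lt_0_compat.
  assert (Hw : Rabs (snd (coords p) - snd (coords q)) <= eta).
  { assert (K : (x h - y h) * (x h - y h) * (1 + eta) < eta * eta * (x h * y h)).
    { apply Rle_lt_trans with ((x h - y h) * (x h - y h) * 2).
      - apply Rmult_le_compat_l; [apply Rle_0_sqr|lra].
      - assert (0 < eta * eta * (x h * y h)) by now apply Rmult_lt_0_compat. lra. }
    assert (snd (coords p) - snd (coords q) <= eta).
    { apply log_gap; [exact H0|]. rewrite Ep, Eq. lra. }
    assert (snd (coords q) - snd (coords p) <= eta).
    { apply log_gap; [exact H0|]. rewrite Ep, Eq. lra. }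
    apply Rabs_le. lra. }
  split; [exact Hw|]. intros m Hm. rewrite Ep. cbn [coords fst]. fold x y.
  assert (Hy : y h <= 3 * x h) by (rewrite <- Ep, <- Eq; now apply exp_close_3 with eta).
  specialize (Hi m ltac:(unfold n; lia)).
  rewrite <- (Rabs_pos_eq (eta * x h)) by (apply Rmult_le_pos; lra).
  apply Rsqr_le_abs_0. unfold Rsqr.
  assert (eta * eta * (x h * y h) <= eta * eta * (x h * (3 * x h)))
    by (repeat (apply Rmult_le_compat_l; [lra|]); exact Hy).
  assert (0 < eta * eta * (x h * x h)) by (repeat apply Rmult_lt_0_compat; assumption).
  nra.
Qed.

(** Together with [close_hdist] this says that [close] and [hdist] induce the same uniform
    structure, which is all that the Higson functions depend on. *)
Lemma hdist_close eta : 0 < eta -> exists r, 0 < r /\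
  forall p q, hdist n p q < r -> close h eta (coords p) (coords q).
Proof.
  intros He. set (e := Rmin eta 1).
  assert (H0 : 0 < e) by (apply Rmin_glb_lt; lra).
  assert (H1 : e <= 1) by apply Rmin_r. assert (H2 : e <= eta) by apply Rmin_l.
  assert (H3 : 0 < e * e / 8) by (assert (0 < e * e) by (now apply Rmult_lt_0_compat); lra).
  exists (ln (1 + e * e / 8)). split; [rewrite <- ln_1; apply ln_increasing; lra|].
  intros p q H. apply close_mono with e; [exact H2|]. apply chord_close; auto.
  rewrite hdist_chord in H. apply arcosh_lower in H; [|apply chord_pos].
  rewrite exp_ln in H by lra. lra.
Qed.

Lemma exp_gap u eta : eta <= 1 / 2 -> Rabs u <= eta -> Rabs (1 - exp u) <= 2 * eta /\ 1 / 2 <= exp u.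
Proof.
  intros He Hu. apply Rabs_le_elim in Hu.
  assert (L : forall v, 1 + v <= exp v).
  { intros v. destruct (Req_dec v 0) as [->|]; [rewrite exp_0; lra|left; now apply exp_ineq1]. }
  pose proof (L u). pose proof (L (- u)) as L'. rewrite exp_Ropp in L'. pose proof (exp_pos u).
  assert (exp u * (1 - u) <= 1).
  { apply Rle_trans with (exp u * / exp u); [apply Rmult_le_compat_l; lra|]. rewrite Rinv_r; lra. }
  split; [|lra]. apply Rabs_le. split; [|lra]. nra.
Qed.

Lemma close_hdist r : 0 < r -> exists eta, 0 < eta /\
  forall p q, close h eta (coords p) (coords q) -> hdist n p q < r.
Proof.
  intros Hr. destruct (arcosh_upper r Hr) as [sg [Hsg Hup]].
  assert (Hn : 0 <= INR n) by apply pos_INR.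
  set (eta := Rmin (1 / 2) (sg / (2 * INR n + 1))).
  assert (H0 : 0 < eta) by (apply Rmin_glb_lt; [lra|apply Rdiv_lt_0_compat; lra]).
  assert (H1 : eta <= 1 / 2) by apply Rmin_l.
  assert (H2 : 2 * INR n * eta < sg).
  { apply Rle_lt_trans with (2 * INR n * (sg / (2 * INR n + 1))).
    - apply Rmult_le_compat_l; [lra|apply Rmin_r].
    - apply Rmult_lt_reg_r with (2 * INR n + 1); [lra|].
      replace (2 * INR n * (sg / (2 * INR n + 1)) * (2 * INR n + 1)) with (2 * INR n * sg) by (field; lra). lra. }
  exists eta. split; [exact H0|]. intros p q [Hw Hx].
  rewrite hdist_chord. apply Hup. split; [apply chord_pos|]. unfold chord.
  pose proof (height_pos p) as Hp. pose proof (height_pos q) as Hq.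
  pose proof (exp_coords p) as Ep. pose proof (exp_coords q) as Eq.
  rewrite Ep in Hx. cbn [coords fst] in Hx.
  set (x := proj1_sig p) in *. set (y := proj1_sig q) in *.
  destruct (exp_gap (snd (coords q) - snd (coords p)) eta H1) as [G1 G2].
  { rewrite Rabs_minus_sym. exact Hw. }
  assert (Ey : y h = x h * exp (snd (coords q) - snd (coords p))).
  { rewrite <- Ep, <- Eq, <- exp_plus. f_equal. ring. }
  set (u := exp (snd (coords q) - snd (coords p))) in *.
  assert (Hi : forall i, (i < n)%nat -> (x i - y i) * (x i - y i) <= (2 * eta * x h) * (2 * eta * x h)).
  { intros i Hi.
    assert (Ha : Rabs (x i - y i) <= 2 * eta * x h).
    { destruct (Nat.eq_dec i h) as [->|N].
      - rewrite Ey. replace (x h - x h * u) with (x h * (1 - u)) by ring.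
        rewrite Rabs_mult, (Rabs_pos_eq (x h)) by lra.
        rewrite (Rmult_comm (2 * eta)). apply Rmult_le_compat_l; lra.
      - specialize (Hx i ltac:(unfold n in Hi; lia)).
        assert (0 <= eta * x h) by (apply Rmult_le_pos; lra). lra. }
    apply Rabs_le_elim in Ha. nra. }
  assert (Hs : sqdist n x y <= INR n * ((2 * eta * x h) * (2 * eta * x h))).
  { rewrite sqdist_lsum. rewrite <- (length_seq n 0) at 2. rewrite <- lsum_const.
    apply lsum_le. intros i Hi'. apply in_seq in Hi'. apply Hi. lia. }
  assert (Hpq : 0 < 2 * x h * y h) by (apply Rmult_lt_0_compat; lra).
  apply Rmult_lt_reg_r with (2 * x h * y h); [exact Hpq|].
  unfold Rdiv. rewrite Rmult_assoc, Rinv_l, Rmult_1_r by lra.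
  eapply Rle_lt_trans; [exact Hs|].
  assert (Hxx : 0 < x h * x h) by now apply Rmult_lt_0_compat.
  apply Rle_lt_trans with (2 * INR n * eta * (x h * x h)).
  - replace (INR n * (2 * eta * x h * (2 * eta * x h))) with (2 * INR n * eta * (x h * x h) * (2 * eta)) by ring.
    rewrite <- (Rmult_1_r (2 * INR n * eta * (x h * x h))) at 2. apply Rmult_le_compat_l; [|lra].
    repeat apply Rmult_le_pos; lra.
  - apply Rlt_le_trans with (sg * (x h * x h)); [apply Rmult_lt_compat_r; assumption|].
    rewrite Ey. replace (sg * (2 * x h * (x h * u))) with (sg * (x h * x h) * (2 * u)) by ring.
    rewrite <- (Rmult_1_r (sg * (x h * x h))) at 1. apply Rmult_le_compat_l; [|lra].
    apply Rmult_le_pos; lra.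
Qed.

Lemma close_triangle eta p q r : 0 <= eta <= 1 -> close h eta p q -> close h eta q r -> close h (4 * eta) p r.
Proof.
  intros He [H1 H2] [H3 H4]. pose proof (exp_close_3 _ _ _ (proj2 He) H1) as H5.
  apply Rabs_le_elim in H1, H3. split; [apply Rabs_le; lra|].
  intros m Hm. specialize (H2 m Hm). specialize (H4 m Hm). apply Rabs_le_elim in H2, H4.
  assert (eta * exp (snd q) <= eta * (3 * exp (snd p))) by (apply Rmult_le_compat_l; lra).
  apply Rabs_le. lra.
Qed.

Lemma hdist_refl p : hdist n p p = 0.
Proof.
  unfold hdist, arcosh. cbv zeta.
  replace (sqdist n (proj1_sig p) (proj1_sig p)) with 0.
  - rewrite Rdiv_0_l, Rplus_0_r, Rmult_1_l, Rminus_diag, sqrt_0, Rplus_0_r. apply ln_1.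
  - rewrite sqdist_lsum, (lsum_ext _ (fun _ => 0)); [rewrite lsum_const; ring|intros; ring].
Qed.

Lemma hdist_triangle r : 0 < r -> exists s, 0 < s /\
  forall x y z, hdist n x y < s -> hdist n y z < s -> hdist n x z < r.
Proof.
  intros Hr. destruct (close_hdist r Hr) as [eta [He H]].
  set (e := Rmin (eta / 4) 1).
  assert (H0 : 0 < e) by (apply Rmin_glb_lt; lra).
  assert (H1 : e <= 1) by apply Rmin_r. assert (H2 : e <= eta / 4) by apply Rmin_l.
  destruct (hdist_close e H0) as [s [Hs H3]]. exists s. split; [exact Hs|].
  intros x y z Hxy Hyz. apply H. apply close_mono with (4 * e); [lra|].
  apply close_triangle with (coords y); auto. lra.
Qed.

Definition of_pt_coord (p : pt) (i : nat) : R :=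
  if Nat.ltb i h then fst p i else if Nat.eqb i h then exp (snd p) else 0.

Lemma of_pt_proof (p : pt) :
  (forall i, (n <= i)%nat -> of_pt_coord p i = 0) /\ 0 < of_pt_coord p (pred n).
Proof.
  unfold of_pt_coord, n. split.
  - intros i Hi. destruct (Nat.ltb_spec i h); [lia|]. destruct (Nat.eqb_spec i h); [lia|reflexivity].
  - cbn [pred]. rewrite Nat.ltb_irrefl, Nat.eqb_refl. apply exp_pos.
Qed.

Definition of_pt (p : pt) : Hpt n := exist _ (of_pt_coord p) (of_pt_proof p).

Lemma coords_of_pt_height p : snd (coords (of_pt p)) = snd p.
Proof. cbn. unfold of_pt_coord. rewrite Nat.ltb_irrefl, Nat.eqb_refl. apply ln_exp. Qed.

Lemma coords_of_pt_horizontal p m : (m < h)%nat -> fst (coords (of_pt p)) m = fst p m.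
Proof. intros Hm. cbn. unfold of_pt_coord. destruct (Nat.ltb_spec m h); [reflexivity|lia]. Qed.

Lemma close_of_pt_r rho p q : close h rho p q -> close h rho p (coords (of_pt q)).
Proof.
  intros [H1 H2]. split; [now rewrite coords_of_pt_height|].
  intros m Hm. rewrite coords_of_pt_horizontal; auto.
Qed.

Lemma close_of_pt_l rho p q : close h rho p q -> close h rho (coords (of_pt p)) q.
Proof.
  intros [H1 H2]. split; [now rewrite coords_of_pt_height|].
  intros m Hm. rewrite coords_of_pt_horizontal, coords_of_pt_height; auto.
Qed.

Lemma higson_close f eps : is_higson_fun (hdist n) f -> 0 < eps -> exists eta, 0 < eta /\
  forall x y, close h eta (coords x) (coords y) -> Rabs (f x - f y) < eps.
Proof.
  intros Hf He.
  destruct (higson_unif_continuous (hdist n) hdist_refl hdist_triangle f Hf eps He) as [r [Hr H]].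
  destruct (close_hdist r Hr) as [eta [Heta Hc]]. exists eta. auto.
Qed.

Lemma close_higson f : fbounded f ->
  (forall eps, 0 < eps -> exists eta, 0 < eta /\
     forall x y, close h eta (coords x) (coords y) -> Rabs (f x - f y) < eps) ->
  is_higson_fun (hdist n) f.
Proof.
  intros Hb H. apply unif_continuous_higson; [exact Hb|]. intros eps He.
  destruct (H eps He) as [eta [Heta Hc]]. destruct (hdist_close eta Heta) as [r [Hr Hd]].
  exists r. auto.
Qed.

(** * A hyperbolic lattice and its bump functions *)

Section Net.
Variable kap : R.
Hypothesis kap_pos : 0 < kap.
Hypothesis kap_small : kap <= 1 / 16.

(** An [l1] distance in units of [kap], with horizontal lengths measured at the height of [p]. *)
Definition gap (p z : pt) : R :=
  lsum (fun m => Rabs (fst p m - fst z m) / (kap * exp (snd p))) (seq 0 h)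
  + Rabs (snd p - snd z) / kap.

Definition bump (p z : pt) : R := Rmax 0 (1 - gap p z).

Lemma gap_terms p z :
  Rabs (snd p - snd z) <= kap * gap p z /\
  forall m, (m < h)%nat -> Rabs (fst p m - fst z m) <= gap p z * (kap * exp (snd p)).
Proof.
  pose proof (exp_pos (snd p)) as He.
  assert (Hk : 0 < kap * exp (snd p)) by now apply Rmult_lt_0_compat.
  assert (T : forall m, 0 <= Rabs (fst p m - fst z m) / (kap * exp (snd p))).
  { intros m. apply Rmult_le_pos; [apply Rabs_pos|left; now apply Rinv_0_lt_compat]. }
  assert (T' : 0 <= Rabs (snd p - snd z) / kap).
  { apply Rmult_le_pos; [apply Rabs_pos|left; now apply Rinv_0_lt_compat]. }
  assert (Hl := lsum_pos (fun m => Rabs (fst p m - fst z m) / (kap * exp (snd p))) (seq 0 h) (fun m _ => T m)).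
  split.
  - replace (Rabs (snd p - snd z)) with (kap * (Rabs (snd p - snd z) / kap)) by (field; lra).
    apply Rmult_le_compat_l; [lra|]. unfold gap. lra.
  - intros m Hm.
    replace (Rabs (fst p m - fst z m)) with (Rabs (fst p m - fst z m) / (kap * exp (snd p)) * (kap * exp (snd p))) by (field; lra).
    apply Rmult_le_compat_r; [lra|]. unfold gap.
    assert (Hm' : In m (seq 0 h)) by (apply in_seq; lia).
    pose proof (lsum_ge (fun m => Rabs (fst p m - fst z m) / (kap * exp (snd p))) (seq 0 h) m (fun m _ => T m) Hm').
    cbv beta in H. lra.
Qed.

Lemma bump_range p z : 0 <= bump p z <= 1.
Proof.
  unfold bump. split; [apply Rmax_l|]. apply Rmax_lub; [lra|].
  assert (0 <= gap p z); [|lra]. destruct (gap_terms p z) as [H _].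
  pose proof (Rabs_pos (snd p - snd z)). apply Rnot_lt_le. intros Hn. nra.
Qed.

Lemma bump_close p z : 0 < bump p z -> close h kap p z.
Proof.
  unfold bump. intros Hb. assert (Hg : gap p z < 1).
  { apply Rnot_le_lt. intros H. rewrite Rmax_left in Hb; lra. }
  destruct (gap_terms p z) as [H1 H2]. pose proof (exp_pos (snd p)).
  assert (Hk : 0 < kap * exp (snd p)) by now apply Rmult_lt_0_compat.
  split.
  - eapply Rle_trans; [exact H1|]. rewrite <- (Rmult_1_r kap) at 2. apply Rmult_le_compat_l; lra.
  - intros m Hm. eapply Rle_trans; [now apply H2|].
    rewrite <- (Rmult_1_l (kap * exp (snd p))) at 2. apply Rmult_le_compat_r; lra.
Qed.

(** The modulus does not depend on [p], so suprema of arbitrary families of bumps remain uniformly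
    continuous. *)
Lemma bump_modulus eps : 0 < eps -> exists eta, 0 < eta /\
  forall p z z', close h eta z z' -> bump p z <= bump p z' + eps.
Proof.
  intros He. set (D := INR h * (3 / kap) + 1 / kap).
  pose proof (pos_INR h).
  assert (H3 : 0 < 3 / kap) by (apply Rdiv_lt_0_compat; lra).
  assert (H1 : 0 < 1 / kap) by (apply Rdiv_lt_0_compat; lra).
  assert (HD : 0 < D) by (unfold D; assert (0 <= INR h * (3 / kap)) by (apply Rmult_le_pos; lra); lra).
  exists (eps / D). split; [now apply Rdiv_lt_0_compat|]. intros p z z' [Hw Hx].
  (* Outside the support there is nothing to show. Inside it the heights of [p] and [z] differ at
     most by a factor [3], the one in [D]. *)
  destruct (Rle_lt_dec (bump p z) 0) as [Hb|Hb].
  { pose proof (bump_range p z'). lra. }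
  pose proof (bump_close p z Hb) as [Hpz _].
  pose proof (exp_close_3 _ _ kap ltac:(lra) Hpz) as E3. pose proof (exp_pos (snd p)) as Hep.
  set (eta := eps / D) in *. assert (Heta : 0 < eta) by now apply Rdiv_lt_0_compat.
  assert (Hg : gap p z' <= gap p z + eps).
  { unfold gap.
    assert (A1 : lsum (fun m => Rabs (fst p m - fst z' m) / (kap * exp (snd p))) (seq 0 h)
      <= lsum (fun m => 1 * (Rabs (fst p m - fst z m) / (kap * exp (snd p))) + eta * (3 / kap)) (seq 0 h)).
    { apply lsum_le. intros m Hm. apply in_seq in Hm. specialize (Hx m ltac:(lia)).
      assert (B : Rabs (fst p m - fst z' m) <= Rabs (fst p m - fst z m) + eta * (3 * exp (snd p))).
      { replace (fst p m - fst z' m) with ((fst p m - fst z m) + (fst z m - fst z' m)) by ring.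
        eapply Rle_trans; [apply Rabs_triang|]. apply Rplus_le_compat_l.
        eapply Rle_trans; [exact Hx|]. apply Rmult_le_compat_l; lra. }
      apply Rmult_le_reg_r with (kap * exp (snd p)); [now apply Rmult_lt_0_compat|].
      replace (Rabs (fst p m - fst z' m) / (kap * exp (snd p)) * (kap * exp (snd p)))
        with (Rabs (fst p m - fst z' m)) by (field; lra).
      replace ((1 * (Rabs (fst p m - fst z m) / (kap * exp (snd p))) + eta * (3 / kap)) * (kap * exp (snd p)))
        with (Rabs (fst p m - fst z m) + eta * (3 * exp (snd p))) by (field; lra).
      exact B. }
    rewrite (lsum_ext (fun m => 1 * (Rabs (fst p m - fst z m) / (kap * exp (snd p))) + eta * (3 / kap))
      (fun m => 1 * (Rabs (fst p m - fst z m) / (kap * exp (snd p))) + eta * (3 / kap) * 1)) in A1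
      by (intros; ring).
    rewrite lsum_lin, (lsum_const 1 (seq 0 h)), length_seq in A1.
    assert (A2 : Rabs (snd p - snd z') / kap <= Rabs (snd p - snd z) / kap + eta * (1 / kap)).
    { apply Rmult_le_reg_r with kap; [exact kap_pos|].
      replace (Rabs (snd p - snd z') / kap * kap) with (Rabs (snd p - snd z')) by (field; lra).
      replace ((Rabs (snd p - snd z) / kap + eta * (1 / kap)) * kap) with (Rabs (snd p - snd z) + eta) by (field; lra).
      replace (snd p - snd z') with ((snd p - snd z) + (snd z - snd z')) by ring.
      eapply Rle_trans; [apply Rabs_triang|]. lra. }
    assert (A3 : eta * D = eps) by (unfold eta; field; lra). unfold D in A3. lra. }
  unfold bump in *. apply Rmax_lub; [pose proof (Rmax_l 0 (1 - gap p z')); lra|].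
  pose proof (Rmax_r 0 (1 - gap p z')). lra.
Qed.

(** With this spacing, rounding all [n] coordinates costs a gap of at most
    [n * kap' / kap = 1 / 4]. *)
Let kap' := kap / (4 * INR n).

Lemma n_pos : 1 <= INR n.
Proof. unfold n. rewrite S_INR. pose proof (pos_INR h). lra. Qed.

Lemma kap'_pos : 0 < kap'.
Proof. pose proof n_pos. apply Rdiv_lt_0_compat; lra. Qed.

(* The lattice point with integer label [j :: i] sits at log-height [kap' j]. *)
Definition net (q : list Z) : pt :=
  let w := kap' * IZR (nth 0 q 0%Z) in
  (fun m => kap' * exp w * IZR (nth (S m) q 0%Z), w).

Lemma floor_error (x s : R) : 0 < s -> Rabs (s * IZR (Int_part (x / s)) - x) <= s.
Proof.
  intros Hs. destruct (base_Int_part (x / s)).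
  replace (s * IZR (Int_part (x / s)) - x) with (s * (IZR (Int_part (x / s)) - x / s)) by (field; lra).
  rewrite Rabs_mult, (Rabs_pos_eq s) by lra. apply Rle_trans with (s * 1); [|lra].
  apply Rmult_le_compat_l; [lra|]. apply Rabs_le. lra.
Qed.

Lemma nth_map_seq (f : nat -> Z) m k : (m < k)%nat -> nth m (map f (seq 0 k)) 0%Z = f m.
Proof.
  intros H. rewrite (nth_indep _ 0%Z (f 0%nat)) by now rewrite length_map, length_seq.
  rewrite map_nth, seq_nth by assumption. reflexivity.
Qed.

Lemma net_dense z : exists q, length q = n /\ 3 / 4 <= bump (net q) z.
Proof.
  pose proof kap'_pos as Hk. pose proof n_pos.
  set (j := Int_part (snd z / kap')). set (w := kap' * IZR j).
  set (s := kap' * exp w). assert (Hs : 0 < s) by (apply Rmult_lt_0_compat; [exact Hk|apply exp_pos]).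
  set (q := j :: map (fun m => Int_part (fst z m / s)) (seq 0 h)).
  exists q. split; [unfold q; cbn; rewrite length_map, length_seq; reflexivity|].
  unfold bump. eapply Rle_trans; [|apply Rmax_r].
  assert (gap (net q) z <= 1 / 4); [|lra].
  unfold gap. change (snd (net q)) with w. pose proof (exp_pos w).
  assert (A1 : lsum (fun m => Rabs (fst (net q) m - fst z m) / (kap * exp w)) (seq 0 h)
     <= lsum (fun _ => kap' / kap) (seq 0 h)).
  { apply lsum_le. intros m Hm. apply in_seq in Hm.
    replace (fst (net q) m) with (s * IZR (Int_part (fst z m / s))).
    2:{ unfold net, q. cbn [fst nth]. rewrite nth_map_seq by lia. reflexivity. }
    apply Rmult_le_reg_r with (kap * exp w); [now apply Rmult_lt_0_compat|].
    replace (kap' / kap * (kap * exp w)) with s by (unfold s; field; lra).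
    unfold Rdiv at 1. rewrite Rmult_assoc, Rinv_l, Rmult_1_r
      by (apply Rgt_not_eq, Rmult_lt_0_compat; lra).
    now apply floor_error. }
  rewrite lsum_const, length_seq in A1.
  assert (A2 : Rabs (w - snd z) / kap <= kap' / kap).
  { apply Rmult_le_compat_r; [left; now apply Rinv_0_lt_compat|]. now apply floor_error. }
  assert (A3 : INR n * (kap' / kap) = 1 / 4) by (unfold kap'; field; lra).
  unfold n in A3. rewrite S_INR in A3. lra.
Qed.

Lemma bump_net_close p q z : 0 < bump p z -> 0 < bump q z -> close h (4 * kap) p q.
Proof.
  intros Hp Hq. apply bump_close in Hp, Hq. destruct Hp as [H1 H2], Hq as [H3 H4].
  apply Rabs_le_elim in H1, H3.
  assert (Hw : Rabs (snd p - snd q) <= 1) by (apply Rabs_le; lra).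
  pose proof (exp_close_3 _ _ 1 (Rle_refl _) Hw). pose proof (exp_pos (snd p)).
  split; [apply Rabs_le; lra|]. intros m Hm.
  specialize (H2 m Hm). specialize (H4 m Hm). apply Rabs_le_elim in H2, H4.
  assert (kap * exp (snd q) <= kap * (3 * exp (snd p))) by (apply Rmult_le_compat_l; lra).
  apply Rabs_le. lra.
Qed.

(** A distance of [4 * kap] amounts to [16 n] lattice steps; one more step absorbs the rounding of a
    horizontal coordinate to the grid of another height. Modulo [2 * rad + 1], a residue determines
    an integer in a window of radius [rad]. *)
Let rad : Z := (16 * Z.of_nat n + 1)%Z.
Let modulus : Z := (2 * rad + 1)%Z.

(** The integer congruent to [b] in the window of radius [rad] around [a]. *)
Definition near (a b : Z) : Z := (a - rad + (b - a + rad) mod modulus)%Z.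

Lemma near_eq a b : (Z.abs (b - a) <= rad)%Z -> near a b = b.
Proof. intros H. unfold near. rewrite Z.mod_small; unfold modulus; lia. Qed.

Lemma near_mod a b : near a (b mod modulus) = near a b.
Proof.
  unfold near. f_equal. replace (b mod modulus - a + rad)%Z with (b mod modulus + (rad - a))%Z by ring.
  rewrite Zplus_mod_idemp_l. f_equal. ring.
Qed.

Definition residue (q : list Z) : list Z := map (fun z => (z mod modulus)%Z) q.

(* The lattice point close to [q0] with the same residues as [t]. *)
Definition neighbour (q0 t : list Z) : list Z :=
  let j := near (nth 0 q0 0%Z) (nth 0 t 0%Z) in
  j :: map (fun m => near (Int_part (fst (net q0) m / (kap' * exp (kap' * IZR j)))) (nth (S m) t 0%Z)) (seq 0 h).

Lemma nth_residue q m : nth m (residue q) 0%Z = (nth m q 0 mod modulus)%Z.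
Proof. unfold residue. rewrite <- (map_nth (fun z => (z mod modulus)%Z)). now rewrite Zmod_0_l. Qed.

Lemma neighbour_residue q0 t : neighbour q0 (residue t) = neighbour q0 t.
Proof.
  unfold neighbour. rewrite nth_residue, near_mod. f_equal. apply map_ext. intros m.
  now rewrite nth_residue, near_mod.
Qed.

(** Residues tell apart the lattice points near [q0]. The height label has to be recovered first,
    since it fixes the horizontal spacing in which the other labels are counted. *)
Lemma neighbour_close q0 t : length t = n -> close h (4 * kap) (net t) (net q0) -> neighbour q0 t = t.
Proof.
  intros Ht [Hw Hx]. pose proof kap'_pos as Hk. pose proof n_pos as Hn.
  assert (E4 : 4 * kap = kap' * IZR (16 * Z.of_nat n)).
  { rewrite mult_IZR, <- INR_IZR_INZ. unfold kap'. field. lra. }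
  assert (Hj : near (nth 0 q0 0%Z) (nth 0 t 0%Z) = nth 0 t 0%Z).
  { apply near_eq. apply Z.le_trans with (16 * Z.of_nat n)%Z; [|unfold rad; lia].
    apply le_IZR. rewrite abs_IZR, minus_IZR. cbn [net snd] in Hw.
    rewrite <- Rmult_minus_distr_l, Rabs_mult, (Rabs_pos_eq kap'), E4 in Hw by lra.
    apply Rmult_le_reg_l with kap'; assumption. }
  destruct t as [|j t']; [discriminate|].
  unfold neighbour. rewrite Hj. cbn [nth]. f_equal.
  apply nth_ext with (d := 0%Z) (d' := 0%Z).
  { rewrite length_map, length_seq. unfold n in Ht. cbn in Ht. lia. }
  rewrite length_map, length_seq. intros m Hm. rewrite nth_map_seq by exact Hm.
  apply near_eq. specialize (Hx m Hm). rewrite E4 in Hx.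
  unfold net at 1 3 in Hx. cbn [fst snd nth] in Hx.
  set (s := kap' * exp (kap' * IZR j)) in *.
  assert (Hs : 0 < s) by (apply Rmult_lt_0_compat; [exact Hk|apply exp_pos]).
  set (x := fst (net q0) m) in *. set (i := nth m t' 0%Z) in *.
  pose proof (floor_error x s Hs) as Hf. set (fl := Int_part (x / s)) in *.
  replace (kap' * IZR (16 * Z.of_nat n) * exp (kap' * IZR j)) with (s * IZR (16 * Z.of_nat n)) in Hx by (unfold s; ring).
  apply le_IZR. rewrite abs_IZR, minus_IZR. unfold rad. rewrite plus_IZR.
  apply Rmult_le_reg_l with s; [exact Hs|].
  rewrite <- (Rabs_pos_eq s) at 1 by lra. rewrite <- Rabs_mult.
  apply Rabs_le_elim in Hx, Hf. apply Rabs_le. lra.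
Qed.

End Net.

(** * Classes of lattice points as Higson functions *)

Section Classes.
Variable kap : R.
Hypothesis kap_pos : 0 < kap.
Hypothesis kap_small : kap <= 1 / 16.

Lemma class_fun_ex (A : list Z -> Prop) (y : Hpt n) : exists r,
  is_lub (fun r => r = 0 \/ exists q, A q /\ r = bump kap (net kap q) (coords y)) r.
Proof.
  destruct (completeness (fun r => r = 0 \/ exists q, A q /\ r = bump kap (net kap q) (coords y))) as [r Hr].
  - exists 1. intros r [->|[q [_ ->]]]; [lra|apply bump_range; assumption].
  - exists 0. now left.
  - now exists r.
Qed.

(** The supremum of the bumps of a class; adjoining the value [0] keeps the set inhabited for an
    empty class. *)
Definition class_fun (A : list Z -> Prop) (y : Hpt n) : R :=
  epsilon (inhabits 0) (fun r =>
    is_lub (fun r => r = 0 \/ exists q, A q /\ r = bump kap (net kap q) (coords y)) r).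

Lemma class_fun_lub A y :
  is_lub (fun r => r = 0 \/ exists q, A q /\ r = bump kap (net kap q) (coords y)) (class_fun A y).
Proof. unfold class_fun. apply epsilon_spec, class_fun_ex. Qed.

Lemma class_fun_ge A y q : A q -> bump kap (net kap q) (coords y) <= class_fun A y.
Proof. intros Hq. apply (class_fun_lub A y). right. now exists q. Qed.

Lemma class_fun_gt A y r : 0 <= r -> r < class_fun A y ->
  exists q, A q /\ r < bump kap (net kap q) (coords y).
Proof.
  intros H0 Hr. apply NNPP. intros N. apply Rlt_not_le in Hr. apply Hr.
  apply (class_fun_lub A y). intros b [->|[q [Hq ->]]]; [exact H0|].
  apply Rnot_lt_le. intros Hb. apply N. now exists q.
Qed.

Lemma class_fun_higson A : is_higson_fun (hdist n) (class_fun A).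
Proof.
  assert (H0 : forall y, 0 <= class_fun A y) by (intros y; apply (class_fun_lub A y); now left).
  assert (H1 : forall y, class_fun A y <= 1).
  { intros y. apply (class_fun_lub A y). intros r [->|[q [_ ->]]]; [lra|apply bump_range; assumption]. }
  apply close_higson.
  - exists 1. intros y. apply Rabs_le. specialize (H0 y). specialize (H1 y). lra.
  - intros eps He. destruct (bump_modulus kap kap_pos kap_small (eps / 2) ltac:(lra)) as [eta [Heta Hm]].
    (* [close] measures at the height of its first argument; the factor [3] pays for exchanging the
       arguments. *)
    set (e := Rmin (eta / 3) 1).
    assert (He0 : 0 < e) by (apply Rmin_glb_lt; lra).
    assert (He1 : e <= 1) by apply Rmin_r. assert (He2 : e <= eta / 3) by apply Rmin_l.
    exists e. split; [exact He0|]. intros x y Hxy.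
    assert (Hyx : close h eta (coords y) (coords x)).
    { destruct Hxy as [K1 K2]. pose proof (exp_close_3 (snd (coords y)) (snd (coords x)) e He1) as K3.
      rewrite Rabs_minus_sym in K3. specialize (K3 K1).
      split; [rewrite Rabs_minus_sym; lra|]. intros m Hm'. specialize (K2 m Hm').
      rewrite Rabs_minus_sym. eapply Rle_trans; [exact K2|].
      apply Rle_trans with (eta / 3 * (3 * exp (snd (coords y)))); [|lra].
      pose proof (exp_pos (snd (coords x))). apply Rmult_le_compat; lra. }
    assert (Hxy' : close h eta (coords x) (coords y)) by (apply close_mono with e; [lra|exact Hxy]).
    assert (L : forall a b, close h eta (coords a) (coords b) -> class_fun A a <= class_fun A b + eps / 2).
    { intros a b Hab. apply (class_fun_lub A a). intros r [->|[q [Hq ->]]].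
      - specialize (H0 b). lra.
      - pose proof (Hm (net kap q) _ _ Hab). pose proof (class_fun_ge A b q Hq). lra. }
    pose proof (L _ _ Hxy'). pose proof (L _ _ Hyx). apply Rabs_def1; lra.
Qed.

Definition class_higson (A : list Z -> Prop) : HigsonFun (Hpt n) (hdist n) :=
  exist _ (class_fun A) (class_fun_higson A).

End Classes.

End Hyperbolic.

(** * Descent to a finite cover *)

Fixpoint words {A : Type} (l : list A) (k : nat) : list (list A) :=
  match k with
  | O => [[]]
  | S k' => flat_map (fun a => map (cons a) (words l k')) l
  end.

Lemma in_words {A : Type} (l : list A) k : forall w, length w = k -> incl w l -> In w (words l k).
Proof.
  induction k as [|k IH]; intros [|a w] Hw Iw; try discriminate; [now left|].
  cbn. apply in_flat_map. exists a. split; [apply Iw; now left|]. apply in_map, IH.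
  - now injection Hw.
  - intros x Hx. apply Iw. now right.
Qed.

Definition Zinterval (a : Z) (k : nat) : list Z := map (fun i => (a + Z.of_nat i)%Z) (seq 0 k).

Lemma in_Zinterval a k z : (a <= z < a + Z.of_nat k)%Z -> In z (Zinterval a k).
Proof.
  intros H. apply in_map_iff. exists (Z.to_nat (z - a)). split; [lia|]. apply in_seq. lia.
Qed.

Lemma finite_bound {A : Type} (f : A -> R) l : exists B, forall a, In a l -> Rabs (f a) <= B.
Proof.
  induction l as [|a l [B IH]].
  - exists 0. intros a [].
  - exists (Rmax B (Rabs (f a))). intros b [<-|Hb]; [apply Rmax_r|].
    eapply Rle_trans; [now apply IH|apply Rmax_l].
Qed.

Lemma finite_representatives {A B : Type} (P : A -> Prop) (code : A -> B) l :
  exists F, forall q, P q -> In (code q) l -> exists q', In q' F /\ P q' /\ code q' = code q.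
Proof.
  induction l as [|b l [F IH]].
  - exists []. intros q _ [].
  - destruct (classic (exists q, P q /\ code q = b)) as [[q0 [H0 E0]]|N].
    + exists (q0 :: F). intros q Hq [E|Hl].
      * exists q0. split; [now left|]. split; [exact H0|congruence].
      * destruct (IH q Hq Hl) as [q' [H1 H2]]. exists q'. split; [now right|exact H2].
    + exists F. intros q Hq [E|Hl]; [exfalso; apply N; now exists q|now apply IH].
Qed.

Lemma in_Zinterval_bounded (b : Z) C : Rabs (IZR b) <= C -> In b (Zinterval (- up C) (Z.to_nat (2 * up C + 1))).
Proof.
  intros H. apply Rabs_le_elim in H. destruct (archimed C) as [H1 _].
  assert (H2 : (- up C < b)%Z) by (apply lt_IZR; rewrite opp_IZR; lra).
  assert (H3 : (b < up C)%Z) by (apply lt_IZR; lra).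
  apply in_Zinterval. lia.
Qed.

Lemma cech_vanishes_hyperbolic h m :
  cech_vanishes (h0pt (Hpt (S h)) (hdist (S h))) (h0open (Hpt (S h)) (hdist (S h))) (S (S m)).
Proof.
  intros I U HU c Hc.
  destruct (h0_lebesgue (hdist (S h)) U HU) as [l [eps [J [Heps HL]]]].
  destruct (common_radius (fun (f : HigsonFun (Hpt (S h)) (hdist (S h))) eta => forall x y,
    close h eta (coords h x) (coords h y) -> Rabs (proj1_sig f x - proj1_sig f y) < eps / 2) l) as [rho' [Hrho' Hl]].
  { intros f r r' Hr H x y Hxy. apply H. apply close_mono with r'; [lra|exact Hxy]. }
  { intros f _. apply higson_close; [exact (proj2_sig f)|lra]. }
  set (rho := Rmin rho' 1).
  assert (Hr0 : 0 < rho) by (apply Rmin_glb_lt; lra).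
  assert (Hr1 : rho <= 1) by apply Rmin_r.
  assert (Hclose : forall f, In f l -> forall x y, close h rho (coords h x) (coords h y) ->
    Rabs (proj1_sig f x - proj1_sig f y) < eps / 2).
  { intros f Hf x y Hxy. apply Hl; [exact Hf|]. apply close_mono with rho; [apply Rmin_l|exact Hxy]. }
  destruct (HL (of_pt h origin)) as [i0 _].
  (* A whole [l], [eps] neighbourhood of [q] lies in the set of index [lam q]. The index comes from
     the finite list [J], so the pulled back cocycle [ct] is bounded on tuples of a given length. *)
  set (lam := fun q : pt => epsilon (inhabits i0) (fun i => In i J /\
    forall p : h0pt (Hpt (S h)) (hdist (S h)), (forall f, In f l ->
      Rabs (proj1_sig p f - proj1_sig f (of_pt h q)) < eps) -> U i p)).
  assert (Hlam : forall q, In (lam q) J /\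
    forall p : h0pt (Hpt (S h)) (hdist (S h)), (forall f, In f l ->
      Rabs (proj1_sig p f - proj1_sig f (of_pt h q)) < eps) -> U (lam q) p).
  { intros q. unfold lam. apply (epsilon_spec (inhabits i0) (fun i => In i J /\
    forall p : h0pt (Hpt (S h)) (hdist (S h)), (forall f, In f l ->
      Rabs (proj1_sig p f - proj1_sig f (of_pt h q)) < eps) -> U i p)), HL. }
  set (ct := fun s : list pt => IZR (c (map lam s))).
  assert (Hct : forall s, dl ct s = IZR (cobound c (map lam s))).
  { intros s. unfold ct. rewrite cobound_dl, dl_map. reflexivity. }
  destruct (finite_bound (fun w => IZR (c w)) (words J (S (S (S m))))) as [B HB].
  destruct (bounded_integral_primitive h rho m ct B Hr0 Hr1) as [b [C [HbC Hb]]].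
  { intros t. now eexists. }
  { intros t Ht. apply HB, in_words; [now rewrite length_map|].
    intros x Hx. apply in_map_iff in Hx. destruct Hx as [q [<- _]]. apply Hlam. }
  { intros t Ht St. rewrite Hct. f_equal. apply Hc; [rewrite length_map; exact Ht|].
    destruct t as [|q0 t']; [discriminate|].
    exists (h0_eval (hdist (S h)) (of_pt h q0)). intros i Hi. apply in_map_iff in Hi.
    destruct Hi as [q [<- Hq]]. apply Hlam. intros f Hf. cbn.
    (* The first vertex, viewed in the compactification, lies in all the sets chosen for the tuple,
       so a small tuple maps to a simplex of the nerve. *)
    apply Rlt_trans with (eps / 2); [|lra]. apply Hclose; [exact Hf|].
    apply close_of_pt_l, close_of_pt_r, St; [now left|exact Hq]. }
  (* Lattice points whose bumps meet are within [4 * kap = rho / 4] of each other, the radius at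
     which [b] is a bounded primitive. *)
  set (kap := rho / 16).
  assert (Hk0 : 0 < kap) by (unfold kap; lra).
  assert (Hk1 : kap <= 1 / 16) by (unfold kap; lra).
  set (good := fun s : list (list Z) => length s = S (S m) /\ small h (rho / 4) (map (net h kap) s)).
  (* The tables also list tuples that are not small, where [b] is uncontrolled; the default [0]
     keeps all entries bounded. *)
  set (b0 := fun s => if excluded_middle_informative (good s) then b (map (net h kap) s) else 0%Z).
  set (modulus := (2 * (16 * Z.of_nat (S h) + 1) + 1)%Z).
  set (residues := words (Zinterval 0 (Z.to_nat modulus)) (S h)).
  assert (Hres : forall q, length q = (S h) -> In (residue h q) residues).
  { intros q Hq. apply in_words; [unfold residue; now rewrite length_map|].
    intros z Hz. apply in_map_iff in Hz. destruct Hz as [z' [<- _]]. apply in_Zinterval.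
    change (0 <= z' mod modulus < 0 + Z.of_nat (Z.to_nat modulus))%Z.
    assert (0 < modulus)%Z by (unfold modulus; lia).
    pose proof (Z.mod_pos_bound z' modulus ltac:(lia)). lia. }
  set (tails := words residues (S m)).
  (* [table q] records the values of the primitive on all tuples starting at [q]: the other vertices
     are determined by [q] and their residues, so the resulting cover is finite. *)
  set (table := fun q => map (fun ts => b0 (q :: map (neighbour h kap q) ts)) tails).
  (* The first entry serves the refinement and the values of the cocycle, the second recovers nearby
     vertices, the third gives the values of the primitive. On lattice labels each has finitely many
     values. *)
  set (code := fun q => (lam (net h kap q), residue h q, table q)).
  set (cls := fun q q' => length q' = (S h) /\ code q' = code q).
  set (G := fun q => class_higson h kap Hk0 Hk1 (cls q)).
  set (V := fun (q : list Z) (p : h0pt (Hpt (S h)) (hdist (S h))) => 1 / 2 < proj1_sig p (G q)).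
  assert (Hnear : forall q y, 0 < bump h kap (net h kap q) (coords h y) ->
    close h (rho / 4) (net h kap q) (coords h y)).
  { intros q y H. apply bump_close in H; [|exact Hk0].
    apply close_mono with kap; [unfold kap; lra|exact H]. }
  exists (list Z), V, (fun q => lam (net h kap q)). split; [split|split].
  - intros q p Hp. exists [G q], (proj1_sig p (G q) - 1 / 2). unfold V in Hp. split; [lra|].
    intros p' H'. specialize (H' (G q) (or_introl eq_refl)). apply Rabs_def2 in H'. unfold V. lra.
  - intros p.
    (* A point [y] approximates [p] on finitely many functions only, so one representative of each
       class is fixed before [y] is chosen. [Rmax C 0] makes room for the default value of [b0]. *)
    destruct (finite_representatives (fun q => length q = (S h)) code
      (list_prod (list_prod J residues)
         (words (Zinterval (- up (Rmax C 0)) (Z.to_nat (2 * up (Rmax C 0) + 1))) (length tails)))) as [F HF].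
    (* A lattice point near [y] has bump at least [3 / 4] there; the tolerance [1 / 4] leaves more
       than the threshold [1 / 2] at [p]. *)
    destruct (proj2_sig p (map G F) (1 / 4) ltac:(lra)) as [y Hy].
    destruct (net_dense h kap Hk0 Hk1 (coords h y)) as [q [Hq Hqy]].
    destruct (HF q Hq) as [q' [Hq' [Hn' Hcode]]].
    + unfold code. apply in_prod; [apply in_prod; [apply Hlam|now apply Hres]|].
      apply in_words; [unfold table; now rewrite length_map|].
      intros z Hz. apply in_map_iff in Hz. destruct Hz as [ts [<- _]]. apply in_Zinterval_bounded.
      unfold b0. destruct excluded_middle_informative as [[Hg1 Hg2]|_].
      * eapply Rle_trans; [|apply Rmax_l]. apply HbC; [now rewrite length_map|exact Hg2].
      * rewrite Rabs_R0. apply Rmax_r.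
    + exists q'. unfold V. specialize (Hy (G q') (in_map G F q' Hq')). apply Rabs_def2 in Hy.
      assert (3 / 4 <= proj1_sig (G q') y); [|lra]. cbn.
      eapply Rle_trans; [exact Hqy|]. apply class_fun_ge; [assumption..|].
      split; [exact Hq|]. congruence.
  - intros q p Hp.
    destruct (proj2_sig p (G q :: l) (Rmin (eps / 2) (proj1_sig p (G q) - 1 / 2))) as [y Hy].
    { unfold V in Hp. apply Rmin_glb_lt; lra. }
    pose proof (Rlt_le_trans _ _ _ (Hy (G q) (or_introl eq_refl)) (Rmin_r _ _)) as H1.
    apply Rabs_def2 in H1. cbn [G class_higson proj1_sig] in H1.
    destruct (class_fun_gt h kap Hk0 (cls q) y (1 / 2)) as [q' [[_ Hq'] Hb']]; [lra|unfold V in Hp; cbn in *; lra|].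
    replace (lam (net h kap q)) with (lam (net h kap q')) by (unfold code in Hq'; congruence).
    apply Hlam. intros f Hf.
    pose proof (Rlt_le_trans _ _ _ (Hy f (or_intror Hf)) (Rmin_l _ _)) as H2.
    assert (H3 : Rabs (proj1_sig f (of_pt h (net h kap q')) - proj1_sig f y) < eps / 2).
    { apply Hclose; [exact Hf|]. apply close_of_pt_l.
      apply close_mono with (rho / 4); [lra|]. apply Hnear. lra. }
    apply Rabs_def2 in H2, H3. apply Rabs_def1; lra.
  (* The labels in [ts] stand for classes and may lie far apart. Only the residues of the tail
     matter: they are realised next to [q]. *)
  - set (bbar := fun ts : list (list Z) => match ts with
      | [] => 0%Z | q :: ts' => b0 (q :: map (neighbour h kap q) ts') end).
    exists bbar. intros t Ht [p Hp].
    assert (Hmin : exists y, forall q, In q t -> 1 / 2 < proj1_sig (G q) y).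
    { destruct (min_pos_list (fun q => proj1_sig p (G q) - 1 / 2) t) as [r [Hr Hr']].
      { intros q Hq. specialize (Hp q Hq). unfold V in Hp. lra. }
      destruct (proj2_sig p (map G t) r Hr) as [y Hy]. exists y. intros q Hq.
      specialize (Hy (G q) (in_map G t q Hq)). specialize (Hr' q Hq). apply Rabs_def2 in Hy. lra. }
    destruct Hmin as [y Hy].
    (* Although [p] may be a point at infinity, [y] is an honest point of hyperbolic space in the
       same sets; [sg q] is a member of the class of [q] near [y]. *)
    set (sg := fun q => epsilon (inhabits []) (fun q' => cls q q' /\
      1 / 2 < bump h kap (net h kap q') (coords h y))).
    assert (Hsg : forall q, In q t -> cls q (sg q) /\ 1 / 2 < bump h kap (net h kap (sg q)) (coords h y)).
    { intros q Hq. unfold sg. apply (epsilon_spec (inhabits []) (fun q' => cls q q' /\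
        1 / 2 < bump h kap (net h kap q') (coords h y))).
      apply class_fun_gt; [assumption..|lra|]. exact (Hy q Hq). }
    assert (Hcl : forall q q', In q t -> In q' t -> close h (rho / 4) (net h kap (sg q)) (net h kap (sg q'))).
    { intros q q' Hq Hq'. replace (rho / 4) with (4 * kap) by (unfold kap; field).
      destruct (Hsg q Hq), (Hsg q' Hq'). apply bump_net_close with (coords h y); [exact Hk0|exact Hk1|lra|lra]. }
    assert (Hface : forall r, S (length r) = length t -> incl r t ->
      IZR (bbar r) = IZR (b (map (fun q => net h kap (sg q)) r))).
    { intros [|q r'] Hr Ir; [cbn in Hr; lia|]. f_equal. cbn [bbar].
      destruct (Hsg q (Ir q (or_introl eq_refl))) as [[Hq1 Hq2] _].
      assert (Hcode : residue h (sg q) = residue h q /\ table (sg q) = table q)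
        by (unfold code in Hq2; split; congruence).
      assert (Hr' : forall x, In x r' -> In x t) by (intros x Hx; apply Ir; now right).
      assert (Hlen : forall x, In x t -> length x = (S h) /\ residue h (sg x) = residue h x).
      { intros x Hx. destruct (Hsg x Hx) as [[Hx1 Hx2] _].
        assert (E : residue h (sg x) = residue h x) by (unfold code in Hx2; congruence).
        split; [|exact E]. rewrite <- Hx1. apply (f_equal (@length Z)) in E.
        unfold residue in E. rewrite !length_map in E. now symmetry. }
      assert (Htail : In (map (residue h) r') tails).
      { apply in_words; [rewrite length_map; cbn in Hr; lia|].
        intros z Hz. apply in_map_iff in Hz. destruct Hz as [x [<- Hx]]. apply Hres, Hlen, Hr', Hx. }
      pose proof (ext_in_map (proj2 Hcode) _ Htail) as Eb. cbv beta in Eb.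
      rewrite !map_map in Eb.
      rewrite (map_ext (fun x => neighbour h kap q (residue h x)) (neighbour h kap q)) in Eb
        by (intros; now apply neighbour_residue).
      rewrite (map_ext_in (fun x => neighbour h kap (sg q) (residue h x)) sg) in Eb.
      (* [sg x] has the residue of [x] and lies close to [sg q], so it is the neighbour of [sg q]
         which that residue selects. *)
      2:{ intros x Hx. destruct (Hlen x (Hr' x Hx)) as [_ <-].
          rewrite neighbour_residue. apply neighbour_close; [exact Hk0|exact Hk1| |].
          - now destruct (Hsg x (Hr' x Hx)) as [[? _] _].
          - replace (4 * kap) with (rho / 4) by (unfold kap; field).
            apply Hcl; [apply Hr', Hx|apply Ir; now left]. }
      rewrite <- Eb. change (sg q :: map sg r') with (map sg (q :: r')).
      unfold b0. destruct excluded_middle_informative as [_|N]; [now rewrite map_map|].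
      exfalso. apply N. split; [rewrite length_map; lia|].
      rewrite map_map. intros u v Hu Hv. apply in_map_iff in Hu, Hv.
      destruct Hu as [u' [<- Hu]], Hv as [v' [<- Hv]]. apply Hcl; apply Ir; assumption. }
    apply eq_IZR. rewrite cobound_dl, (dl_ext t _ (fun r => IZR (b (map (fun q => net h kap (sg q)) r)))) by exact Hface.
    rewrite <- (dl_map (fun q => net h kap (sg q)) t (fun s => IZR (b s))), Hb.
    + unfold ct. do 2 f_equal. rewrite map_map. apply map_ext_in. intros q Hq.
      destruct (Hsg q Hq) as [[_ E] _]. unfold code in E. congruence.
    + now rewrite length_map.
    + intros u v Hu Hv. apply in_map_iff in Hu, Hv.
      destruct Hu as [u' [<- Hu]], Hv as [v' [<- Hv]]. now apply Hcl.
Qed.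

Theorem theorem5p1 (n : nat) (hn : (2 <= n)%nat) (k : nat) (hk : (1 < k)%nat) :
  cech_vanishes (h0pt (Hpt n) (hdist n)) (h0open (Hpt n) (hdist n)) k.
Proof.
  destruct n as [|h]; [lia|]. destruct k as [|[|m]]; [lia|lia|].
  apply cech_vanishes_hyperbolic.
Qed.
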